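(* Let $\mathfrak h$ be a $d$-dimensional abelian Lie algebra over $\mathbb C$ with a nondegenerate symmetric bilinear form, and let $\nu$ be an isometry of $\mathfrak h$ with $\nu^p=1$ ($p\ge1$) preserving a rational lattice in $\mathfrak h$. Let $L^{\nu;r}(n)=L^{\nu;r,r}(n)$ and $\bar L^{\nu;r}(n)=\bar L^{\nu;r,r}(n)$ ($n\in\mathbb Z$, $r\in\mathbb N$) be the operators on $S[\nu]$ defined in the context. (a) The assignment $L_n^{(r)}\mapsto L^{\nu;r}(n)$, $c\mapsto d$, defines a representation of the Lie algebra $\hat{\mathcal D}^+$ on $S[\nu]$. (b) The assignment $\bar L_n^{(r)}\mapsto\bar L^{\nu;r}(n)$, $c\mapsto d$, also defines a representation of the Lie algebra $\hat{\mathcal D}^+$ on $S[\nu]$, with the central term being a pure monomial; that is, $$[\bar L^{\nu;r}(m),\bar L^{\nu;s}(n)]=\sum_{i=\min(r,s)}^{r+s}a_i^{(r,s)}(m,n)\,\bar L^{\nu;i}(m+n)+\frac{((r+s+1)!)^2}{2\,(2(r+s)+3)!}\,m^{2(r+s)+3}\,\delta_{m+n,0}\,d .$$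
   Context: $\mathbb N$ denotes the nonnegative integers. The algebra $\hat{\mathcal D}^+$. Let $D=t\frac{d}{dt}$ and let $\mathcal D$ be the Lie algebra of formal differential operators spanned by $t^nD^r$, $n\in\mathbb Z$, $r\in\mathbb N$, with bracket $[t^mf(D),t^ng(D)]=t^{m+n}(f(D+n)g(D)-g(D+m)f(D))$ for polynomials $f,g$. Let $\Psi$ be the 2-cocycle with $\Psi(t^mf(D),t^ng(D))=-\Psi(t^ng(D),t^mf(D))=\delta_{m+n,0}\sum_{i=1}^mf(-i)g(m-i)$ for $m>0$ (and $0$ for $m=n=0$). $\mathcal D^+$ is the Lie subalgebra of $\mathcal D$ generated (in fact spanned) by $L_n^{(r)}=(-1)^{r+1}D^r(t^nD)D^r$, $n\in\mathbb Z,r\in\mathbb N$. $\hat{\mathcal D}^+=\mathbb Cc\oplus\mathcal D^+$ is its central extension by the restricted cocycle $-\frac12\Psi$ (bracket $[a,b]_{\mathcal D}-\frac12\Psi(a,b)c$, $c$ central), and $L_n^{(r)}$ are viewed as elements of $\hat{\mathcal D}^+$. Set $\bar L_n^{(r)}=L_n^{(r)}+\frac{(-1)^r}2\zeta(-1-2r)\delta_{n,0}c$, with $\zeta$ the Riemann zeta function. Structure constants: write the symmetric polynomial $f^{(r,s)}(n;x_1,x_2)=(-1)^{s+1}\big((x_2+n)^{r+s+1}x_1^rx_2^s+(x_1+n)^{r+s+1}x_1^sx_2^r\big)$ uniquely as $\sum_{i=\min(r,s)}^{r+s}f_i^{(r,s)}(n;x_1+x_2)(x_1x_2)^i$; then $a_i^{(r,s)}(m,n)=f_i^{(r,s)}(n;-m-n)$.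 The space $S[\nu]$. Fix a primitive $p$-th root of unity $\omega_p$. For $r\in\mathbb Z$, $\mathfrak h_{(r)}=\{\alpha\in\mathfrak h:\nu\alpha=\omega_p^r\alpha\}$ and $\alpha_{(r)}$ is the projection of $\alpha$ on $\mathfrak h_{(r)}$. $\hat{\mathfrak h}[\nu]=\coprod_{n\in\frac1p\mathbb Z}\mathfrak h_{(pn)}\otimes t^n\oplus\mathbb CC$ with $C$ central and $[\alpha\otimes t^m,\beta\otimes t^n]=\langle\alpha,\beta\rangle m\,\delta_{m+n,0}C$ for $\alpha\in\mathfrak h_{(pm)}$, $\beta\in\mathfrak h_{(pn)}$. With $\hat{\mathfrak h}[\nu]^{\pm}=\coprod_{\pm n>0}\mathfrak h_{(pn)}\otimes t^n$, $S[\nu]=\mathcal U(\hat{\mathfrak h}[\nu])\otimes_{\mathcal U(\hat{\mathfrak h}[\nu]^+\oplus\mathfrak h_{(0)}\oplus\mathbb CC)}\mathbb C$, where $\hat{\mathfrak h}[\nu]^+\oplus\mathfrak h_{(0)}$ acts trivially on $\mathbb C$ and $C$ acts as $1$. For $\alpha\in\mathfrak h$, $n\in\frac1p\mathbb Z$, $\alpha^\nu(n)$ is the action of $\alpha_{(pn)}\otimes t^n$ on $S[\nu]$, and $\alpha^\nu\langle x\rangle=\sum_{n\in\frac1p\mathbb Z}\alpha^\nu(n)x^{-n}$. $\{\alpha_q\}_{q=1}^d$ is an orthonormal basis of $\mathfrak h$; the normal ordering ${:}\cdot{:}$ places $\alpha^\nu(n)$ with $n>0$ to the right. The existence of a $\nu$-stable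 rational lattice (a free abelian group spanning $\mathfrak h$ with rational-valued form) is a standing assumption. The operators. Put $$L^{\nu;y_1,y_2}\langle x\rangle=\frac12\sum_{q=1}^d{:}\alpha_q^\nu\langle e^{y_1}x\rangle\alpha_q^\nu\langle e^{y_2}x\rangle{:}-\frac12\frac{\partial}{\partial y_1}\Bigg(\sum_{k=0}^{p-1}\frac{(e^{\frac{k(-y_1+y_2)}p}-1)\dim\mathfrak h_{(k)}}{1-e^{-y_1+y_2}}\Bigg),$$ $$\bar L^{\nu;y_1,y_2}\langle x\rangle=\frac12\sum_{q=1}^d{:}\alpha_q^\nu\langle e^{y_1}x\rangle\alpha_q^\nu\langle e^{y_2}x\rangle{:}-\frac12\frac{\partial}{\partial y_1}\Bigg(\sum_{k=0}^{p-1}\frac{e^{\frac{k(-y_1+y_2)}p}\dim\mathfrak h_{(k)}}{1-e^{-y_1+y_2}}\Bigg),$$ where $\frac1{1-e^{-y_1+y_2}}$ means $(y_1-y_2)^{-1}$ (expanded in nonnegative powers of $y_2$) times a power series in $y_1,y_2$. Define the operators $L^{\nu;r_1,r_2}(n)$, $\bar L^{\nu;r_1,r_2}(n)$ by the expansions $$L^{\nu;y_1,y_2}\langle x\rangle=\sum_{n\in\mathbb Z,\,r_1,r_2\in\mathbb N}L^{\nu;r_1,r_2}(n)x^{-n}\frac{y_1^{r_1}y_2^{r_2}}{r_1!r_2!},\qquad \bar L^{\nu;y_1,y_2}\langle x\rangle=\frac12\frac{d}{(y_1-y_2)^2}+\sum_{n\in\mathbb Z,\,r_1,r_2\in\mathbb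 N}\bar L^{\nu;r_1,r_2}(n)x^{-n}\frac{y_1^{r_1}y_2^{r_2}}{r_1!r_2!}.$$ *)

(* Defs.v *)
From HB Require Import structures.
From mathcomp Require Import all_boot all_order all_algebra.
From mathcomp Require Import all_classical all_reals all_analysis.
From mathcomp Require Import complex.

Set Implicit Arguments.
Unset Strict Implicit.
Unset Printing Implicit Defensive.

Import Order.TTheory GRing.Theory Num.Theory.
Import numFieldNormedType.Exports.

Local Open Scope classical_set_scope.
Local Open Scope ring_scope.

(* A Lie algebra is a subset G of an ambient vector space L, with a bracket
   br : L -> L -> L of which only the values on G matter. *)
Section LieAlgebra.
Variables (K : fieldType) (L : lmodType K) (br : L -> L -> L).

Definition lie_generated (X : set L) : set L :=
  [set x | forall P : set L,
     P 0 -> (forall a y z, P y -> P z -> P (a *: y + z)) ->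
     (forall y z, P y -> P z -> P (br y z)) -> X `<=` P -> P x].

(* act restricted to G is a representation of G on W *)
Definition lie_module (G : set L) (W : lmodType K) (act : L -> W -> W) : Prop :=
  [/\ forall a x y w, G x -> G y ->
        act (a *: x + y) w = a *: act x w + act y w,
      forall x, G x -> linear (act x) &
      forall x y w, G x -> G y ->
        act (br x y) w = act x (act y w) - act y (act x w)].

Definition equivariant (G : set L) (V W : lmodType K)
    (actV : L -> V -> V) (actW : L -> W -> W) (f : V -> W) : Prop :=
  linear f /\ forall x v, G x -> f (actV x v) = actW x (f v).

(* (S, i : V -> S) is U(G) (x)_{U(B)} V, for B a subalgebra of G and V a
   B-module: extension of scalars is left adjoint to the restriction from
   G-modules to B-modules, with unit i : v |-> 1 (x) v. *)
Definition is_induced (G B : set L) (V : lmodType K) (actV : L -> V -> V)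
    (S : lmodType K) (actS : L -> S -> S) (i : V -> S) : Prop :=
  [/\ lie_module G actS,
      equivariant B actV actS i &
      forall (W : lmodType K) (actW : L -> W -> W) (j : V -> W),
        lie_module G actW -> equivariant B actV actW j ->
        exists! f : S -> W, equivariant G actS actW f /\ f \o i = j].

End LieAlgebra.

(* An element sum_n t^n f_n(D) is represented by n |-> f_n. *)
Section DifferentialOperators.
Variable K : fieldType.

Definition diffop : lmodType K := (int -> {poly K} : lmodType K).

Definition tmon (n : int) (f : {poly K}) : diffop :=
  fun k => if k == n then f else 0.

(* t^m f(D) . t^n g(D) = t^(m+n) f(D+n) g(D) *)
Definition dmul (a b : diffop) : diffop := fun k =>
  \sum_(m \in [set: int]) (a m \Po ('X + ((k - m)%:~R)%:P)) * b (k - m).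

Definition dbr (a b : diffop) : diffop := dmul a b - dmul b a.

Definition psi0 (m : nat) (f g : {poly K}) : K :=
  \sum_(1 <= i < m.+1) f.[- i%:R] * g.[m%:R - i%:R].

Definition psi (a b : diffop) : K :=
  \sum_(m \in [set: nat])
     (psi0 m (a m%:Z) (b (- m%:Z)) - psi0 m (b m%:Z) (a (- m%:Z))).

Definition Lgen (n : int) (r : nat) : diffop :=
  (-1) ^+ r.+1 *:
    dmul (tmon 0 'X^r) (dmul (tmon n 'X) (tmon 0 'X^r)).

Definition Dplus : set diffop :=
  lie_generated dbr [set a | exists n r, a = Lgen n r].

(* (a, z) stands for a + z c *)
Definition diffop_hat : lmodType K := (diffop * K^o : lmodType K)%type.

Definition dbr_hat (x y : diffop_hat) : diffop_hat :=
  (dbr x.1 y.1, - 2^-1 * psi x.1 y.1).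

Definition Dplus_hat : set diffop_hat := [set x | Dplus x.1].

Definition c_hat : diffop_hat := (0, 1).

Definition L_hat (n : int) (r : nat) : diffop_hat := (Lgen n r, 0).

(* The assignment L_hat n r |-> T n r, c |-> d, for lifts L_hat of the L_n^(r),
   extends to a representation of Dplus_hat. *)
Definition defines_representation (S : lmodType K)
    (gen : int -> nat -> diffop_hat) (T : int -> nat -> S -> S) (d : K) : Prop :=
  exists rho : diffop_hat -> S -> S,
    [/\ lie_module dbr_hat Dplus_hat rho,
        forall n r v, rho (gen n r) v = T n r v &
        forall v, rho c_hat v = d *: v].

(* f^(r,s)(n; x1, x2), with x1 = 'X and x2 = 'X%:P *)
Definition fpoly (r s : nat) (n : int) : {poly {poly K}} :=
  let x1 : {poly {poly K}} := 'X in let x2 : {poly {poly K}} := 'X%:P in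
  (-1) ^+ s.+1 * ((x2 + n%:~R) ^+ (r + s).+1 * x1 ^+ r * x2 ^+ s
                 + (x1 + n%:~R) ^+ (r + s).+1 * x1 ^+ s * x2 ^+ r).

Definition fcoef (r s : nat) (n : int) : nat -> {poly K} :=
  xget (fun=> 0) [set g : nat -> {poly K} |
    fpoly r s n =
      \sum_(minn r s <= i < (r + s).+1)
         (map_poly polyC (g i) \Po ('X + 'X%:P)) * ('X * 'X%:P) ^+ i].

Definition struct_const (r s i : nat) (m n : int) : K :=
  (fcoef r s n i).[(- m - n)%:~R].

End DifferentialOperators.

Section Zeta.
Variable R : realType.

(* The Riemann zeta function on the real line minus {1}, by the Hasse-Sondow
   globally convergent series: (1 - 2^(1-s)) zeta(s) is the Dirichlet eta
   function, given by the Euler transform of sum_n (-1)^n (n+1)^(-s). *)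
Definition zeta (s : R) : R :=
  (1 - 2 `^ (1 - s))^-1 *
  limn (series (fun n : nat =>
    2 ^- n.+1 * \sum_(k < n.+1) (-1) ^+ k * 'C(n, k)%:R * (k.+1)%:R `^ (- s))).

Definition Lbar_hat (n : int) (r : nat) : diffop_hat R[i] :=
  L_hat R[i] n r +
  (((-1) ^+ r / 2 * (zeta (- 1 - (2 * r)%:R))%:C%C * (n == 0)%:R) *: c_hat R[i]).

End Zeta.

(* Power series in z are functions nat -> K, Laurent series in z are functions
   int -> K, and F a b is the coefficient of y1^a y2^b in F : int -> nat -> K. *)
Section FormalSeries.
Variable K : fieldType.

Definition ps_exp (c : K) : nat -> K := fun n => c ^+ n / (n`!)%:R.

Definition ps_mul (f g : nat -> K) : nat -> K :=
  fun n => \sum_(i < n.+1) f i * g (n - i)%N.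

(* 1 / f = sum_k (1 - f)^k, for f with constant term 1 *)
Definition ps_inv (f : nat -> K) : nat -> K :=
  fun n => \sum_(k < n.+1) ((1 - \poly_(i < n.+1) f i) ^+ k)`_n.

(* f(z) / (1 - e^(-z)) = z^(-1) f(z) ((1 - e^(-z)) / z)^(-1) *)
Definition div_1mexp (f : nat -> K) : int -> K := fun N =>
  if N + 1 is Posz n
  then ps_mul f (ps_inv (fun n => (-1) ^+ n / ((n.+1)`!)%:R)) n else 0.

Definition gbin (N : int) (j : nat) : K :=
  (\prod_(i < j) (N - i%:Z)%:~R) / (j`!)%:R.

(* H(y1 - y2), where (y1 - y2)^N = sum_j gbin N j y1^(N-j) (-y2)^j *)
Definition subst_y1my2 (H : int -> K) : int -> nat -> K :=
  fun a b => H (a + b%:Z) * gbin (a + b%:Z) b * (-1) ^+ b.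

Definition deriv_y1 (F : int -> nat -> K) : int -> nat -> K :=
  fun a b => (a + 1)%:~R * F (a + 1) b.

End FormalSeries.

Section TwistedSpace.
Variables (K : fieldType) (h : vectType K).

Definition rational_lattice (form : {symmetric h}) (Lam : set h) : Prop :=
  exists (n : nat) (e : n.-tuple h),
    [/\ forall c : 'I_n -> int, \sum_(i < n) e`_i *~ c i = 0 -> forall i, c i = 0,
        Lam = [set x | inIntSpan e x],
        <<e>>%VS = fullv &
        forall x y, Lam x -> Lam y -> exists q : rat, form x y = ratr q].

Variables (form : {symmetric h}) (nu : 'End(h)) (p : nat) (w : K).

Definition eigsp (k : int) : {vspace h} := passmx.leigenspace nu (w ^ k).

(* the projection on eigsp k along the other eigenspaces of nu *)
Definition eigproj (k : int) : 'End(h) :=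
  daddv_pi (eigsp k) (\sum_(s < p | w ^ k != w ^+ s) eigsp s%:Z)%VS.

(* (a, z) stands for sum_k a_k (x) t^(k/p) + z C, so that k = pn throughout. *)
Definition hhat_ambient : lmodType K := ((int -> h) * K^o : lmodType K)%type.

Definition hhat_br (x y : hhat_ambient) : hhat_ambient :=
  (0, \sum_(k \in [set: int]) form (x.1 k) (y.1 (- k)) * (k%:~R / p%:R)).

Definition hhat : set hhat_ambient :=
  [set x | finite_set [set k | x.1 k != 0] /\ forall k, x.1 k \in eigsp k].

(* hhat^+ + h_(0) + K C *)
Definition hhat_nonneg : set hhat_ambient :=
  [set x | hhat x /\ forall k, k < 0 -> x.1 k = 0].

Definition C_act (x : hhat_ambient) (z : K^o) : K^o := x.2 * z.

Definition is_S_nu (S : lmodType K) (act : hhat_ambient -> S -> S)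
    (vac : S) : Prop :=
  is_induced hhat_br hhat hhat_nonneg C_act act (fun z : K^o => (z : K) *: vac).

Variables (S : lmodType K) (act : hhat_ambient -> S -> S).

(* alpha^nu(k/p) *)
Definition amode (al : h) (k : int) (v : S) : S :=
  act ((fun j : int => if j == k then eigproj k al else 0), 0) v.

(* :alpha^nu(k/p) beta^nu(l/p): *)
Definition normal_ord (al : h) (k : int) (be : h) (l : int) (v : S) : S :=
  if 0 < k then amode be l (amode al k v) else amode al k (amode be l v).

Variables (d : nat) (alpha : d.-tuple h).

(* coefficient of x^(-N) y1^r1 y2^r2 in
   1/2 sum_q :alpha_q<e^y1 x> alpha_q<e^y2 x>:, where the coefficient of x^(-m)
   in alpha<e^y x> is alpha(m) e^(-my) *)
Definition quad_coef (r1 r2 : nat) (N : int) (v : S) : S :=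
  2^-1 *: \sum_(q < d) \sum_(k \in [set: int])
    let l := p%:Z * N - k in
    (ps_exp (- (k%:~R / p%:R)) r1 * ps_exp (- (l%:~R / p%:R)) r2) *:
      normal_ord (tnth alpha q) k (tnth alpha q) l v.

(* with z = y1 - y2 : sum_k dim h_(k) (e^(-kz/p) - 1), and the same without
   the -1 *)
Definition num_z : nat -> K := fun n =>
  \sum_(k < p) (ps_exp (- (k%:R / p%:R)) n - (n == 0%N)%:R)
                * (\dim (eigsp k%:Z))%:R.
Definition numbar_z : nat -> K := fun n =>
  \sum_(k < p) ps_exp (- (k%:R / p%:R)) n * (\dim (eigsp k%:Z))%:R.

Definition corr (f : nat -> K) : int -> nat -> K := fun a b =>
  - 2^-1 * deriv_y1 (subst_y1my2 (div_1mexp f)) a b.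

(* 1/2 d (y1 - y2)^(-2) *)
Definition pole : int -> nat -> K := fun a b =>
  2^-1 * d%:R * subst_y1my2 (fun N => (N == - 2%:Z)%:R) a b.

Definition L_op (r1 r2 : nat) (n : int) (v : S) : S :=
  (r1`! * r2`!)%:R *:
    (quad_coef r1 r2 n v + ((n == 0)%:R * corr num_z r1%:Z r2) *: v).

Definition Lbar_op (r1 r2 : nat) (n : int) (v : S) : S :=
  (r1`! * r2`!)%:R *:
    (quad_coef r1 r2 n v
     + ((n == 0)%:R * (corr numbar_z r1%:Z r2 - pole r1%:Z r2)) *: v).

End TwistedSpace.

(* Main.v *)
Require Import Defs.
From HB Require Import structures.
From mathcomp Require Import all_boot all_order all_algebra.
From mathcomp Require Import all_classical all_reals all_analysis.
From mathcomp Require Import complex.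
From mathcomp Require Import ring zify.

Set Implicit Arguments.
Unset Strict Implicit.
Unset Printing Implicit Defensive.

Import Order.TTheory GRing.Theory Num.Theory.
Import numFieldNormedType.Exports.

Local Open Scope classical_set_scope.
Local Open Scope ring_scope.

(** The operators act on [S] through their commutators with the modes
    alpha(mu), mu in (1/p)Z.  The quadratic operator attached to t^n f(D),
      A = 1/2 sum_q sum_kappa (f(-kappa)/kappa) :alpha_q(kappa) alpha_q(n-kappa):,
    satisfies [A, beta(mu)] = f(mu) beta(mu+n) as soon as f satisfies
      (X+n) f(X) + X f(-X-n) = 0,
    so that t^n f(D) acts on the modes as it does on the powers t^mu
    ([quadop_mode]).  The operators all of whose components satisfy this
    condition form a Lie algebra that contains D^+ ([Dplus_sub]), and working
    in it avoids choosing a basis of D^+.  Since A is quadratic, the bracket of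
    two such operators is determined up to a scalar, which comes from normally
    ordering again finitely many products ([quadop_bracket]).  For t^m f(D) and
    t^(-m) g(D) with m >= 0 it is
      -1/2 sum (dim h_(k)) f(k/p) g(k/p+m)   over -pm <= k < 0.

    The constant terms of the operators absorb this scalar.  Let P_f be the
    polynomial with P_f(x+1) - P_f(x) = f(x) and P_f(0) = 0, and let
      theta(f) = 1/2 sum_(0<=k<p) (dim h_(k)) P_f(k/p).
    The bracket of t^m f and t^(-m) g has the form F(X-m) - F(X) with
    F(X) = f(X) g(X+m), so that P telescopes on it; as F is the summand of both
    the cocycle Psi and the scalar above, this gives the cocycle identity
    ([theta_bracket]) and a representation [hat_act].  Its constant terms on
    the generators are those of (a), because the exponential generating
    function of the P_(X^j)(a) is, up to signs, (e^(-az)-1)/(1-e^(-z))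
    ([Pmon_horner], [corr_num_z]).

    For the representation of (b) the generators only change by multiples of
    c.  The difference of the constant terms is given by the coefficients of
    1/(1-e^(-z)), that is, by Bernoulli numbers, and these are the values of
    zeta at the negative odd integers ([zeta_odd]): on polynomials the Euler
    transform of the eta function is a finite sum, and it satisfies the same
    recursion as the Bernoulli numbers ([eulsumXn]).

    Finally, the explicit bracket in (b) follows from the identity between
    the brackets in D^+ and the structure constants ([Lpoly_bracket]) and from
    the value of the central term ([central_term]).  With N = r+s+1 and
    phi(x) = x^N (m-x)^N, the cocycle is, up to sign, sum_(1<=i<=m) phi(i), and
    sum_i a_i (-1)^i x^(2i+1) = phi(x) - phi(x+m).  The zeta-regularized sum
    Z(phi) = sum_(i>=1) phi(i) satisfies
      Z(phi) - Z(phi(.+m)) = sum_(1<=i<=m) phi(i) - int_0^m phi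
    ([zreg_shift]), and the integral is Beta(N+1, N+1) m^(2N+1). *)

(** * Sums with finite support *)

Lemma addr_idem (V : zmodType) (x : V) : x = x + x -> x = 0.
Proof. by rewrite -{1}[x]addr0 => /addrI. Qed.

Lemma natr_fact_neq0 (K : numFieldType) n : n`!%:R != 0 :> K.
Proof. by rewrite pnatr_eq0 -lt0n fact_gt0. Qed.

Section FiniteSupport.
Variable I : choiceType.

(** [F] vanishes off a finite list; the sums over all of [I] below are the
    finite sums over the support. *)
Definition fsupp (V : zmodType) (F : I -> V) :=
  exists r : seq I, forall k, k \notin r -> F k = 0.

Lemma fsumE (V : zmodType) (F : I -> V) (r : seq I) :
  (forall k, k \notin r -> F k = 0) ->
  \sum_(k \in [set: I]) F k = \sum_(k <- undup r) F k.
Proof.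
move=> Fr; rewrite (bigfs _ (r := undup r) (P := xpredT)) ?undup_uniq//.
  by apply: eq_fsbigl; apply/seteqP; split.
by move=> i _; rewrite mem_undup => /Fr.
Qed.

Lemma fsupp_cat (V W : zmodType) (F : I -> V) (G : I -> W) :
  fsupp F -> fsupp G -> exists r : seq I,
    (forall k, k \notin r -> F k = 0) /\ (forall k, k \notin r -> G k = 0).
Proof.
move=> [r Fr] [s Gs]; exists (r ++ s).
by split=> k; rewrite mem_cat negb_or => /andP[? ?]; [exact: Fr|exact: Gs].
Qed.

Lemma fsuppD (V : zmodType) (F G : I -> V) :
  fsupp F -> fsupp G -> fsupp (fun k => F k + G k).
Proof.
move=> sF sG; have [r [Fr Gr]] := fsupp_cat sF sG.
by exists r => k kr; rewrite Fr// Gr// addr0.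
Qed.

Lemma fsupp_map (V W : zmodType) (f : I -> V -> W) (F : I -> V) :
  (forall k, f k 0 = 0) -> fsupp F -> fsupp (fun k => f k (F k)).
Proof. by move=> f0 [r Fr]; exists r => k /Fr ->. Qed.

Lemma fsumD (V : zmodType) (F G : I -> V) : fsupp F -> fsupp G ->
  \sum_(k \in [set: I]) (F k + G k) =
  \sum_(k \in [set: I]) F k + \sum_(k \in [set: I]) G k.
Proof.
move=> sF sG; have [r [Fr Gr]] := fsupp_cat sF sG.
rewrite (fsumE Fr) (fsumE Gr) -big_split; apply: fsumE => k kr.
by rewrite Fr// Gr// addr0.
Qed.

Lemma fsum_morph (V W : zmodType) (f : V -> W) (F : I -> V) :
  f 0 = 0 -> {morph f : x y / x + y} -> fsupp F ->
  f (\sum_(k \in [set: I]) F k) = \sum_(k \in [set: I]) f (F k).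
Proof.
move=> f0 fD [r Fr]; rewrite (fsumE Fr) (fsumE (r := r)).
  exact: (big_morph f fD f0).
by move=> k /Fr ->.
Qed.

Lemma fsumZ (K : nzRingType) (V : lmodType K) (c : K) (F : I -> V) : fsupp F ->
  c *: (\sum_(k \in [set: I]) F k) = \sum_(k \in [set: I]) c *: F k.
Proof. by apply: fsum_morph; [rewrite scaler0|move=> x y; rewrite scalerDr]. Qed.

Lemma fsumN (V : zmodType) (F : I -> V) : fsupp F ->
  - (\sum_(k \in [set: I]) F k) = \sum_(k \in [set: I]) - F k.
Proof. by apply: fsum_morph; [rewrite oppr0|move=> x y; rewrite opprD]. Qed.

Lemma fsum1 (V : zmodType) (k0 : I) (F : I -> V) :
  (forall k, k != k0 -> F k = 0) -> \sum_(k \in [set: I]) F k = F k0.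
Proof.
move=> Fk; rewrite (fsumE (r := [:: k0])) ?big_seq1// => k.
by rewrite inE => /Fk.
Qed.

Lemma fsumT_ext (V : zmodType) (F G : I -> V) : F =1 G ->
  \sum_(k \in [set: I]) F k = \sum_(k \in [set: I]) G k.
Proof. by move=> FG; apply: eq_fsbigr => k _; exact: FG. Qed.

Lemma fsupp_sum (V : zmodType) (n : nat) (F : 'I_n -> I -> V) :
  (forall q, fsupp (F q)) -> fsupp (fun k => \sum_(q < n) F q k).
Proof.
move=> sF; have /choice[r Fr] := sF.
exists (flatten [seq r q | q <- enum 'I_n]) => k kr.
apply: big1 => q _; apply: Fr; apply: contra kr => kr.
by apply/flatten_mapP; exists q; rewrite ?mem_enum.
Qed.

Lemma fsum_exchange (V : zmodType) (n : nat) (F : 'I_n -> I -> V) :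
  (forall q, fsupp (F q)) ->
  \sum_(q < n) \sum_(k \in [set: I]) F q k =
  \sum_(k \in [set: I]) \sum_(q < n) F q k.
Proof.
move=> sF; have /choice[r Fr] := sF.
set R := flatten [seq r q | q <- enum 'I_n].
have FR q k : k \notin R -> F q k = 0.
  move=> kr; apply: Fr; apply: contra kr => kr.
  by apply/flatten_mapP; exists q; rewrite ?mem_enum.
rewrite (fsumE (r := R)); last by move=> k kR; apply: big1 => q _; exact: FR.
rewrite exchange_big /=; apply: eq_bigr => q _; exact/fsumE/FR.
Qed.

End FiniteSupport.

Lemma fsum_shift (V : zmodType) (m : int) (F : int -> V) :
  \sum_(k \in [set: int]) F k = \sum_(k \in [set: int]) F (k + m).
Proof.
by apply: reindex_fsbigT; exists (fun k => k - m) => k; rewrite ?addrK ?subrK.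
Qed.

Lemma fsupp_shift (V : zmodType) (m : int) (F : int -> V) :
  fsupp F -> fsupp (fun k => F (k + m)).
Proof.
move=> [r Fr]; exists [seq k - m | k <- r] => k kr; apply: Fr.
by apply: contra kr => kr; apply/mapP; exists (k + m); rewrite ?addrK.
Qed.

(** * Formal power series and Bernoulli numbers *)

Lemma poly_natroots (K : numFieldType) (q : {poly K}) :
  (forall n : nat, q.[n%:R] = 0) -> q = 0.
Proof.
move=> q0; apply/eqP; apply: contraT => qn0.
have := @max_poly_roots _ q [seq i%:R | i <- iota 0 (size q)] qn0.
rewrite size_map size_iota ltnn map_inj_uniq ?iota_uniq; last first.
  by move=> i j /eqP; rewrite eqr_nat => /eqP.
by apply=> //; apply/allP => x /mapP[i _ ->]; rewrite /root q0.
Qed.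

Section PowerSeries.
Variable K : fieldType.
Implicit Types f g h : nat -> K.

(** The part of degree less than [N] of a power series *)
Definition trunc N f : {poly K} := \poly_(i < N) f i.

Lemma ps_mulE N f g n : (n < N)%N ->
  ps_mul f g n = (trunc N f * trunc N g)`_n.
Proof.
move=> nN; rewrite coefM /ps_mul; apply: eq_bigr => -[i /=]; rewrite ltnS => i_n _.
by rewrite !coef_poly (leq_ltn_trans i_n nN) (leq_ltn_trans (leq_subr _ _) nN).
Qed.

Lemma ps_mulA : associative (@ps_mul K).
Proof.
move=> f g h; apply/funext => n.
transitivity ((trunc n.+1 f * (trunc n.+1 g * trunc n.+1 h))`_n).
  rewrite coefM; apply: eq_bigr => -[i /=]; rewrite ltnS => i_n _.
  by rewrite coef_poly ltnS i_n -ps_mulE// ltnS leq_subr.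
rewrite mulrA coefM; apply: eq_bigr => -[i /=]; rewrite ltnS => i_n _.
by rewrite -ps_mulE ?ltnS// coef_poly ltnS leq_subr.
Qed.

Lemma ps_mulC : commutative (@ps_mul K).
Proof. by move=> f g; apply/funext => n; rewrite !(@ps_mulE n.+1)// mulrC. Qed.

Definition ps_one : nat -> K := fun n => (n == 0%N)%:R.

Lemma ps_mul1 : left_id ps_one (@ps_mul K).
Proof.
move=> f; apply/funext => n; rewrite /ps_mul big_ord_recl /ps_one/= mul1r subn0.
by rewrite big1 ?addr0// => i _; rewrite mul0r.
Qed.

Lemma ps_mulDl : left_distributive (@ps_mul K) (fun f g => f + g).
Proof.
move=> f g h; apply/funext => n; rewrite /ps_mul -[RHS]big_split/=.
by apply: eq_bigr => i _; rewrite mulrDl.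
Qed.

(** The commutative ring of formal power series, a copy of the functions on
    [nat] on which the product is [ps_mul] and not the pointwise one *)
Definition fps := nat -> K.
HB.instance Definition _ := GRing.Zmodule.copy fps (nat -> K).

Lemma ps_one_neq0 : ps_one != 0 :> fps.
Proof. by apply/eqP => /(congr1 (fun f => f 0%N)) /eqP; rewrite oner_eq0. Qed.

HB.instance Definition _ := GRing.Zmodule_isComNzRing.Build fps
  ps_mulA ps_mulC ps_mul1 ps_mulDl ps_one_neq0.

Lemma fps_mulE (f g : fps) : f * g = ps_mul f g. Proof. by []. Qed.

Lemma fpsBE (f g : fps) n : (f - g) n = f n - g n. Proof. by []. Qed.
Lemma fpsDE (f g : fps) n : (f + g) n = f n + g n. Proof. by []. Qed.
Lemma fps1E n : (1 : fps) n = (n == 0%N)%:R. Proof. by []. Qed.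

(** The variable z *)
Definition fps_X : fps := fun n => (n == 1%N)%:R.

Lemma fps_mulX0 (f : fps) : (fps_X * f) 0%N = 0.
Proof. by rewrite fps_mulE /ps_mul big_ord1 /fps_X mul0r. Qed.

Lemma fps_mulXS (f : fps) n : (fps_X * f) n.+1 = f n.
Proof.
rewrite fps_mulE /ps_mul big_ord_recl /fps_X/= mul0r add0r big_ord_recl/= mul1r.
by rewrite subSS subn0 big1 ?addr0// => i _; rewrite mul0r.
Qed.

Lemma fps_mulXI : injective (fun f : fps => fps_X * f).
Proof.
move=> f g e; apply/funext => n.
by rewrite -fps_mulXS -[RHS]fps_mulXS e.
Qed.

Lemma coefX_eq n (q r : {poly K}) k : (forall i, (i <= n)%N -> q`_i = r`_i) ->
  forall i, (i <= n)%N -> (q ^+ k)`_i = (r ^+ k)`_i.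
Proof.
move=> qr; elim: k => [|k IH] i i_n; first by rewrite !expr0.
rewrite !exprS !coefM; apply: eq_bigr => -[j /=]; rewrite ltnS => ji _.
by rewrite qr ?IH//; [exact: leq_trans (leq_subr _ _) i_n|exact: leq_trans ji i_n].
Qed.

Lemma coefX_lt (q : {poly K}) k i : q`_0 = 0 -> (i < k)%N -> (q ^+ k)`_i = 0.
Proof.
move=> q0 ik; have /factor_theorem[r ->] : root q 0 by rewrite /root horner_coef0 q0.
by rewrite subr0 exprMn coefMXn ik.
Qed.

(** The powers of 1 - f of index greater than n do not contribute to the
    coefficient of z^n, so that one truncation order serves all coefficients. *)
Lemma ps_inv_truncE f n N : f 0%N = 1 -> (n < N)%N ->
  ps_inv f n = (\sum_(k < N) (1 - trunc N f) ^+ k)`_n.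
Proof.
move=> f0 nN; rewrite coef_sum -(big_mkord xpredT (fun k => ((1 - trunc N f) ^+ k)`_n)).
rewrite (big_cat_nat (n := n.+1))//= [X in _ = _ + X]big_nat_cond [X in _ = _ + X]big1.
  rewrite addr0 big_mkord; apply: eq_bigr => k _; apply: (@coefX_eq n) => // i i_n.
  by rewrite !coefB !coef_poly ltnS i_n (leq_ltn_trans i_n nN).
move=> k /andP[/andP[nk _] _]; apply: coefX_lt => //.
by rewrite coefB coef1 coef_poly (leq_ltn_trans _ nN)// f0 subrr.
Qed.

Lemma ps_invP (f : fps) : f 0%N = 1 -> f * ps_inv f = 1.
Proof.
move=> f0; apply/funext => n; rewrite fps_mulE.
transitivity ((trunc n.+1 f * \sum_(k < n.+1) (1 - trunc n.+1 f) ^+ k)`_n).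
  rewrite coefM; apply: eq_bigr => -[i /=]; rewrite ltnS => i_n _.
  by rewrite coef_poly ltnS i_n (@ps_inv_truncE _ _ n.+1)// ltnS leq_subr.
set u := 1 - trunc n.+1 f; have -> : trunc n.+1 f = - (u - 1) by rewrite /u; ring.
rewrite mulNr -subrX1 opprB coefB coef1 coefX_lt ?subr0//.
by rewrite /u coefB coef1 coef_poly f0 subrr.
Qed.

End PowerSeries.

Section Bernoulli.
Variable K : numFieldType.

Let fact_neq0 := natr_fact_neq0 K.

(** The series e^(cz) *)
Definition fexp (c : K) : fps K := ps_exp c.

Lemma fexpD (x y : K) : fexp x * fexp y = fexp (x + y).
Proof.
apply/funext => n; rewrite fps_mulE /ps_mul /fexp /ps_exp addrC exprDn mulr_suml.
apply: eq_bigr => -[i /=]; rewrite ltnS => i_n _.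
rewrite -[X in _ = X / _]mulr_natr -(bin_fact i_n) !natrM.
have := fact_neq0 i; have := fact_neq0 (n - i).
have : 'C(n, i)%:R != 0 :> K by rewrite pnatr_eq0 -lt0n bin_gt0.
move: ('C(n, i)%:R) (i`!%:R) ((n - i)`!%:R) (x ^+ i) (y ^+ (n - i)).
move=> c u v X Y c0 v0 u0. by field; rewrite c0 u0 v0.
Qed.

Lemma fexp0 : fexp (0 : K) = 1.
Proof.
apply/funext => -[|n]; first by rewrite /fexp /ps_exp expr0 fact0 divr1.
by rewrite /fexp /ps_exp expr0n mul0r.
Qed.

(** (1 - e^(-z)) / z *)
Definition exp_quot : fps K := fun n => (-1) ^+ n / ((n.+1)`!)%:R.

(** z / (1 - e^(-z)), whose coefficients are B_n / n! with B_1 = 1/2 *)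
Definition bern : fps K := ps_inv exp_quot.

Lemma exp_quotE : fps_X K * exp_quot = 1 - fexp (- 1).
Proof.
apply/funext => -[|n]; rewrite fpsBE fps1E.
  by rewrite fps_mulX0 /fexp /ps_exp expr0 fact0 divr1 subrr.
by rewrite fps_mulXS /exp_quot /fexp /ps_exp sub0r exprS mulN1r mulNr opprK.
Qed.

Lemma exp_quot0 : exp_quot 0%N = 1.
Proof. by rewrite /exp_quot expr0 divr1. Qed.

Lemma exp_quot_bern : exp_quot * bern = 1.
Proof. exact: ps_invP exp_quot0. Qed.

Lemma bern0 : bern 0%N = 1.
Proof.
have := congr1 (fun f : fps K => f 0%N) exp_quot_bern.
by rewrite /= fps_mulE /ps_mul big_ord1 exp_quot0 mul1r.
Qed.

Lemma bern_exp : bern * (fexp 1 - 1) = fps_X K * fexp 1.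
Proof.
have -> : fexp 1 - 1 = fexp 1 * (1 - fexp (- 1)).
  by rewrite mulrBr mulr1 fexpD subrr fexp0.
rewrite -exp_quotE; transitivity (fexp 1 * fps_X K * (exp_quot * bern)); first by ring.
by rewrite exp_quot_bern mulr1 mulrC.
Qed.

End Bernoulli.

(** * Indefinite sums of polynomials *)

Section PolyFunctionals.
Variables (K : numFieldType) (V : lmodType K).

(** The linear map that sends each monomial X^j to c_j *)
Definition plin (c : nat -> V) (f : {poly K}) : V :=
  \sum_(j < size f) f`_j *: c j.

Lemma plinE c (f : {poly K}) N : (size f <= N)%N -> plin c f = \sum_(j < N) f`_j *: c j.
Proof.
move=> fN; rewrite /plin (big_ord_widen _ (fun j => f`_j *: c j) fN) big_mkcond.
by apply: eq_bigr => j _; case: ltnP => // /leq_sizeP -> //; rewrite scale0r.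
Qed.

Lemma plin_is_linear c : linear (plin c).
Proof.
move=> k f g; set N := maxn (size f) (size g).
rewrite !(@plinE _ _ N) ?leq_maxr ?leq_maxl//; last first.
  by rewrite (leq_trans (size_polyD _ _))// geq_max leq_maxr andbT (leq_trans (size_scale_leq _ _))// leq_maxl.
rewrite scaler_sumr -big_split; apply: eq_bigr => j _ /=.
by rewrite coefD coefZ scalerDl scalerA.
Qed.

HB.instance Definition _ c :=
  GRing.isLinear.Build K {poly K} V _ (plin c) (plin_is_linear c).

Lemma plinXn c n : plin c 'X^n = c n.
Proof.
rewrite /plin size_polyXn big_ord_recr/= coefXn eqxx scale1r big1 ?add0r// => i _.
by rewrite coefXn ltn_eqF// scale0r.
Qed.

End PolyFunctionals.

Section SummationPolynomials.
Variable K : numFieldType.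

Let fact_neq0 := natr_fact_neq0 K.

(** The polynomial P with P(x+1) - P(x) = x^j and P(0) = 0, that is,
    (B_(j+1)(X) - B_(j+1)(0)) / (j+1) *)
Definition Pmon (j : nat) : {poly K} := ((-1) ^+ j.+1 * j`!%:R) *:
  \sum_(i < j.+1) ((-1) ^+ i.+1 / (i.+1)`!%:R * bern K (j - i)%N) *: 'X^(i.+1).

Lemma Pmon_horner j x :
  (Pmon j).[x] = (-1) ^+ j.+1 * j`!%:R * ((fexp (- x) - 1) * bern K) j.+1.
Proof.
rewrite /Pmon hornerZ horner_sum; congr (_ * _).
rewrite fps_mulE /ps_mul [RHS]big_ord_recl fpsBE fps1E /=.
rewrite /fexp /ps_exp expr0 fact0 divr1 subrr mul0r add0r; apply: eq_bigr => i _.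
rewrite fpsBE fps1E subr0 hornerZ hornerXn /bump /= add1n subSS.
rewrite [(- x) ^+ _]exprNn; ring.
Qed.

Lemma Pmon_delta j x : (Pmon j).[x + 1] - (Pmon j).[x] = x ^+ j.
Proof.
rewrite !Pmon_horner -mulrBr -fpsBE -mulrBl.
have -> : (fexp (- (x + 1)) - 1 - (fexp (- x) - 1)) * bern K
   = fps_X K * (0 - fexp (- x)).
  rewrite opprD -fexpD.
  transitivity (- fexp (- x) * ((1 - fexp (-1)) * bern K)); first by ring.
  rewrite -exp_quotE -(mulrA _ (exp_quot K)) exp_quot_bern; ring.
rewrite fps_mulXS fpsBE /fexp /ps_exp sub0r [(- x) ^+ _]exprNn [(-1) ^+ j.+1]exprS.
have : (-1) ^+ j * (-1) ^+ j = 1 :> K by rewrite -expr2 sqrr_sign.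
have := fact_neq0 j; move: (j`!%:R) ((-1) ^+ j) (x ^+ j) => c e X c0 ee.
by transitivity ((e * e) * X); [field|rewrite ee mul1r].
Qed.

Lemma Pmon0 j : (Pmon j).[0] = 0.
Proof. by rewrite Pmon_horner oppr0 fexp0 subrr mul0r mulr0. Qed.

(** The indefinite sum of f: the polynomial P_f such that
    P_f(x+1) - P_f(x) = f(x) and P_f(0) = 0 *)
Definition Psum (f : {poly K}) : {poly K} := plin Pmon f.

Lemma PsumD f g : Psum (f + g) = Psum f + Psum g.
Proof. exact: linearD. Qed.
Lemma PsumZ c f : Psum (c *: f) = c *: Psum f.
Proof. exact: linearZ. Qed.
Lemma PsumXn n : Psum 'X^n = Pmon n.
Proof. exact: plinXn. Qed.

Lemma Psum_delta f x : (Psum f).[x + 1] - (Psum f).[x] = f.[x].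
Proof.
rewrite /Psum /plin !horner_sum -sumrB [in RHS]horner_coef.
apply: eq_bigr => i _. by rewrite hornerZ [X in _ - X]hornerZ -mulrBr Pmon_delta.
Qed.

Lemma Psum0 f : (Psum f).[0] = 0.
Proof.
by rewrite /Psum /plin horner_sum big1// => i _; rewrite hornerZ Pmon0 mulr0.
Qed.

Lemma horner_periodic (q : {poly K}) x :
  (forall y, q.[y + 1] = q.[y]) -> q.[x] = q.[0].
Proof.
move=> qp; suff /eqP : q - (q.[0])%:P = 0.
  by rewrite subr_eq0 => /eqP ->; rewrite !hornerC.
apply: poly_natroots; elim => [|n IH]; first by rewrite !hornerE subrr.
by move: IH; rewrite -natr1 !hornerE qp.
Qed.

Lemma horner_shift (f : {poly K}) c x : (f \Po ('X + c%:P)).[x] = f.[x + c].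
Proof. by rewrite horner_comp !hornerE. Qed.

(** Both sides have the same difference, since the sum on the right telescopes,
    and they agree at 0; hence they agree by periodicity. *)
Lemma Psum_telescope m (F : {poly K}) x :
  (Psum ((F \Po ('X + (- m%:R)%:P)) - F)).[x] =
  - \sum_(j < m) (F.[x - j.+1%:R] - F.[- j.+1%:R]).
Proof.
set h := _ - F.
pose G := \sum_(j < m) (F \Po ('X + (- j.+1%:R)%:P)).
have GE y : G.[y] = \sum_(j < m) F.[y - j.+1%:R].
  by rewrite /G horner_sum; apply: eq_bigr => j _; rewrite horner_shift.
have Gd y : G.[y + 1] - G.[y] = - h.[y].
  rewrite !GE -sumrB /h hornerD hornerN horner_shift.
  have -> : - (F.[y - m%:R] - F.[y]) =
      \sum_(0 <= j < m) (- F.[y - j.+1%:R] - - F.[y - j%:R]).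
    by rewrite (telescope_sumr (fun j => - F.[y - j%:R]))// subr0; ring.
  rewrite big_mkord; apply: eq_bigr => j _.
  have -> : y + 1 - j.+1%:R = y - j%:R by rewrite -natr1; ring.
  by ring.
have := @horner_periodic (Psum h + G) x _.
rewrite !hornerD Psum0 add0r => e.
rewrite -[LHS](addrK G.[x]) e.
  rewrite !GE [in RHS]sumrB opprB; congr (_ - _).
  by apply: eq_bigr => j _; rewrite sub0r.
move=> y; rewrite !hornerD; apply/eqP; rewrite -subr_eq0 opprD addrACA Gd.
by rewrite Psum_delta subrr.
Qed.

End SummationPolynomials.

(** * Antiderivatives and the Beta integral *)

Section Antiderivative.
Variable K : numFieldType.

(** The antiderivative that vanishes at 0 *)
Definition integ (f : {poly K}) : {poly K} :=
  plin (fun j => j.+1%:R^-1 *: 'X^(j.+1)) f.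

Lemma integD f g : integ (f + g) = integ f + integ g.
Proof. exact: linearD. Qed.
Lemma integZ c f : integ (c *: f) = c *: integ f.
Proof. exact: linearZ. Qed.
Lemma integXn n : integ 'X^n = n.+1%:R^-1 *: 'X^(n.+1).
Proof. exact: plinXn. Qed.

Lemma integ0 f : (integ f).[0] = 0.
Proof.
rewrite /integ /plin horner_sum big1// => i _.
by rewrite !hornerZ hornerXn expr0n !mulr0.
Qed.

Lemma deriv_integ f : (integ f)^`() = f.
Proof.
rewrite /integ /plin raddf_sum /= -[in RHS](coefK f) poly_def.
apply: eq_bigr => i _; rewrite !derivZ derivXn /= -['X^i *+ _]scaler_nat (scalerA _^-1).
by rewrite mulVf ?scale1r// pnatr_eq0.
Qed.

Lemma deriv_inj (f g : {poly K}) : f^`() = g^`() -> f.[0] = g.[0] -> f = g.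
Proof.
rewrite !horner_coef0 => dfg fg0; apply/polyP => -[//|i].
have := congr1 (fun q : {poly K} => q`_i) dfg; rewrite /= !coef_deriv => /eqP.
by rewrite eqrMn2r/= => /eqP.
Qed.

Lemma integ_deriv f : integ f^`() = f - (f.[0])%:P.
Proof.
apply: deriv_inj; first by rewrite deriv_integ derivB derivC subr0.
by rewrite integ0 !hornerE subrr.
Qed.

Lemma integ_shift f c x :
  (integ (f \Po ('X + c%:P))).[x] = (integ f).[x + c] - (integ f).[c].
Proof.
have -> : integ (f \Po ('X + c%:P)) = (integ f \Po ('X + c%:P)) - ((integ f).[c])%:P.
  apply: deriv_inj.
    rewrite derivB derivC subr0 deriv_integ deriv_comp deriv_integ.
    by rewrite derivD derivX derivC addr0 mulr1.
  by rewrite integ0 hornerD hornerN hornerC horner_shift add0r subrr.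
by rewrite hornerD hornerN hornerC horner_shift.
Qed.

(** Induction on [b], integrating by parts *)
Lemma beta_integral a b (m : K) :
  (integ ('X^a * (m%:P - 'X) ^+ b)).[m] =
  (a`! * b`!)%:R / ((a + b).+1)`!%:R * m ^+ (a + b).+1.
Proof.
have f0 n : n`!%:R != 0 :> K by rewrite pnatr_eq0 -lt0n fact_gt0.
have n0 n : n.+1%:R != 0 :> K by rewrite pnatr_eq0.
elim: b a => [|b IH] a.
  rewrite expr0 mulr1 integXn hornerZ hornerXn addn0 fact0 muln1 factS natrM.
  have := n0 a; have := f0 a; move: (a.+1%:R) (a`!%:R) => u v v0 u0.
  by field; rewrite u0 v0.
have dE : ('X^(a.+1) * (m%:P - 'X) ^+ b.+1 : {poly K})^`() =
    a.+1%:R *: ('X^a * (m%:P - 'X) ^+ b.+1)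
    + (- b.+1%:R) *: ('X^(a.+1) * (m%:P - 'X) ^+ b).
  rewrite derivM derivXn deriv_exp derivB derivC derivX sub0r /=.
  by rewrite scaleNr !scaler_nat mulrnAl mulrnAr mulN1r mulrN mulNrn.
have := congr1 (fun q => q.[m]) (integ_deriv ('X^(a.+1) * (m%:P - 'X) ^+ b.+1)).
rewrite dE integD !integZ hornerD !hornerZ IH.
have -> : ('X^(a.+1) * (m%:P - 'X) ^+ b.+1 - ('X^(a.+1) * (m%:P - 'X) ^+ b.+1).[0]%:P).[m] = 0.
  by rewrite !(hornerE, horner_exp) subrr !expr0n !(mulr0, mul0r) subrr.
move=> /eqP; rewrite addr_eq0 mulNr opprK => /eqP e.
apply: (mulfI (n0 a)); rewrite e addSnnS.
have -> : (a.+1)`! = (a.+1 * a`!)%N by [].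
have -> : (b.+1)`! = (b.+1 * b`!)%N by [].
rewrite !natrM; move: (_^-1) => ?; ring.
Qed.

End Antiderivative.

(** * Zeta-regularized sums of polynomials *)

Section ZetaValues.
Variable K : numFieldType.

Let f0 := natr_fact_neq0 K.

(** -B_(j+1) / (j+1), the value of zeta at -j *)
Definition zeta_neg (j : nat) : K := - (j`!%:R * bern K j.+1).

(** The zeta-regularized value of the sum of the f(n), n >= 1 *)
Definition zreg (f : {poly K}) : K := plin (zeta_neg : nat -> K^o) f.

Lemma zregD f g : zreg (f + g) = zreg f + zreg g.
Proof. exact: (linearD (plin (zeta_neg : nat -> K^o))). Qed.
Lemma zregZ c f : zreg (c *: f) = c * zreg f.
Proof. exact: (linearZ_LR (plin (zeta_neg : nat -> K^o))). Qed.
Lemma zregXn n : zreg 'X^n = zeta_neg n.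
Proof. exact: (plinXn (zeta_neg : nat -> K^o)). Qed.
Lemma zreg0 : zreg 0 = 0.
Proof. exact: (linear0 (plin (zeta_neg : nat -> K^o))). Qed.
Lemma zreg_sum I (r : seq I) (F : I -> {poly K}) :
  zreg (\sum_(i <- r) F i) = \sum_(i <- r) zreg (F i).
Proof. exact: (big_morph _ zregD zreg0). Qed.

Lemma binom_fact (i j : nat) (x : K) : (i <= j)%N ->
  (i`!%:R * x) *+ 'C(j, i) = j`!%:R * (x / (j - i)`!%:R).
Proof.
move=> ij; rewrite -(bin_fact ij) !natrM -mulr_natr.
move: ('C(j, i)%:R) => c.
by move: (f0 (j - i)); move: (_`!%:R) (_`!%:R) => u v u0; field.
Qed.

Lemma expXD1 j : ('X + 1%:P : {poly K}) ^+ j = \sum_(i < j.+1) 'X^i *+ 'C(j, i).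
Proof.
rewrite addrC exprDn; apply: eq_bigr => i _.
by rewrite expr1n mul1r.
Qed.

Lemma zeta_neg_rec j : \sum_(i < j.+1) zeta_neg i *+ 'C(j, i) = zeta_neg j - 1 + j.+1%:R^-1.
Proof.
have := congr1 (fun f : fps K => f j.+1) (bern_exp K).
rewrite /= mulrBr mulr1 fpsBE fps_mulXS {1}fps_mulE /ps_mul big_ord_recl /=.
rewrite bern0 mul1r subn0 /fexp /ps_exp !expr1n => e.
rewrite (eq_bigr (fun i : 'I_j.+1 =>
   - (j`!%:R * (bern K i.+1 * (1 ^+ (j - i) / (j - i)`!%:R))))); last first.
  move=> i _; rewrite /zeta_neg mulNrn binom_fact ?expr1n ?mul1r//.
  by rewrite -ltnS.
rewrite sumrN -mulr_sumr.
have -> : \sum_(i < j.+1) bern K i.+1 * (1 ^+ (j - i) / (j - i)`!%:R) =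
   1 / j`!%:R + bern K j.+1 - 1 / (j.+1)`!%:R.
  rewrite -e; set s := \sum_(i < j.+1) _;
  by ring.
rewrite /zeta_neg factS natrM.
have : j.+1%:R != 0 :> K by rewrite pnatr_eq0.
have := f0 j; move: (j`!%:R) (j.+1%:R) (bern K j.+1) => u v w u0 v0.
by field; rewrite u0 v0.
Qed.

(** Regularization does not commute with translations: the shifted sum lacks the
    term f(1) and gains the integral of f over [0, 1]. *)
Lemma zreg_shift1 f :
  zreg (f \Po ('X + 1%:P)) = zreg f - f.[1] + (integ f).[1].
Proof.
rewrite comp_polyE zreg_sum {2}/zreg /plin [f.[1]]horner_coef /integ /plin horner_sum.
rewrite -sumrB -big_split; apply: eq_bigr => i _ /=.
rewrite zregZ expXD1 zreg_sum hornerZ hornerZ hornerXn !expr1n !mulr1.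
rewrite (eq_bigr (fun k : 'I__ => zeta_neg k *+ 'C(i, k))); last first.
  by move=> k _; rewrite -scaler_nat zregZ zregXn mulr_natl.
by rewrite zeta_neg_rec mulrDr mulrBr mulr1.
Qed.

Lemma zreg_shift f m :
  zreg (f \Po ('X + m%:R%:P)) = zreg f - \sum_(i < m) f.[i.+1%:R] + (integ f).[m%:R].
Proof.
elim: m => [|m IH].
  by rewrite big_ord0 addr0 comp_polyXr integ0 subr0 addr0.
have -> : f \Po ('X + m.+1%:R%:P) = (f \Po ('X + m%:R%:P)) \Po ('X + 1%:P).
  rewrite -comp_polyA; congr (_ \Po _).
  by rewrite comp_polyD comp_polyX comp_polyC -natr1 polyCD addrA addrAC.
rewrite zreg_shift1 IH integ_shift horner_shift big_ord_recr /=.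
have -> : 1 + m%:R = m.+1%:R :> K by rewrite -natr1 addrC.
by ring.
Qed.

End ZetaValues.

(** * The values of zeta at the negative odd integers *)

Section HasseSondow.
Variable K : numFieldType.

Let f0 := natr_fact_neq0 K.

(** The n-th difference of f at 1, up to the sign (-1)^n *)
Definition altdiff (n : nat) (f : {poly K}) : K :=
  \sum_(k < n.+1) (-1) ^+ k * 'C(n, k)%:R * f.[k.+1%:R].

Lemma altdiff_lin n c f g :
  altdiff n (c *: f + g) = c * altdiff n f + altdiff n g.
Proof.
rewrite /altdiff mulr_sumr -big_split; apply: eq_bigr => k _ /=.
by rewrite hornerD hornerZ; ring.
Qed.
Lemma altdiffD n (f g : {poly K}) : altdiff n (f + g) = altdiff n f + altdiff n g.
Proof. by have := altdiff_lin n 1 f g; rewrite scale1r mul1r. Qed.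
Lemma altdiff0 n : altdiff n 0 = 0.
Proof. by rewrite /altdiff big1// => k _; rewrite horner0 mulr0. Qed.
Lemma altdiffZ n c f : altdiff n (c *: f) = c * altdiff n f.
Proof. by have := altdiff_lin n c f 0; rewrite altdiff0 !addr0. Qed.

Lemma altdiffS n f : altdiff n.+1 f = altdiff n f - altdiff n (f \Po ('X + 1%:P)).
Proof.
rewrite /altdiff big_ord_recl /= bin0 expr0 !mul1r.
rewrite (eq_bigr (fun k : 'I_n.+1 =>
   (-1) ^+ k.+1 * 'C(n, k.+1)%:R * f.[k.+2%:R] -
   (-1) ^+ k * 'C(n, k)%:R * (f \Po ('X + 1%:P)).[k.+1%:R])); last first.
  move=> k _; rewrite /bump /= add1n binS natrD horner_shift.
  by rewrite natr1 exprS; ring.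
rewrite sumrB addrA; congr (_ - _).
rewrite big_ord_recr /= bin_small// mulr0 mul0r addr0.
by rewrite [RHS]big_ord_recl /= bin0 expr0 !mul1r.
Qed.

Lemma size_shift_sub (f : {poly K}) : (size (f - (f \Po ('X + 1%:P)))%R <= (size f).-1)%N.
Proof.
rewrite comp_polyE -[X in (X - _)]coefK poly_def -sumrB.
apply: (leq_trans (size_sum _ _ _)); apply/bigmax_leqP => i _.
rewrite -scalerBr (leq_trans (size_scale_leq _ _))//.
rewrite expXD1 big_ord_recr /= binn mulr1n opprD addrCA subrr addr0 size_polyN.
apply: (leq_trans (size_sum _ _ _)); apply/bigmax_leqP => k _.
rewrite -scaler_nat (leq_trans (size_scale_leq _ _))// size_polyXn.
apply: leq_trans (ltn_ord k) _; rewrite -ltnS (ltn_predK (ltn_ord i)). exact: ltn_ord.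
Qed.

Lemma altdiff_eq0 n (f : {poly K}) : (size f <= n)%N -> altdiff n f = 0.
Proof.
elim: n f => [|n IH] f sf.
  by move: sf; rewrite leqn0 size_poly_eq0 => /eqP ->; rewrite altdiff0.
rewrite altdiffS -mulN1r -altdiffZ -altdiffD scaleN1r; apply: IH.
by rewrite (leq_trans (size_shift_sub f))//; case: (size f) sf.
Qed.

(** The partial sums of the Euler transform of the alternating series with terms
    (-1)^n f(n+1), n >= 0; they are constant for N large *)
Definition eulsum (N : nat) (f : {poly K}) := \sum_(n < N) 2^-1 ^+ n.+1 * altdiff n f.

(** The recursion that determines the Euler-transformed sums; the sum telescopes
    after the shifted differences are expressed by [altdiffS]. *)
Lemma eulsum_shift N (f : {poly K}) : (size f <= N)%N ->
  eulsum N (f \Po ('X + 1%:P)) = f.[1] - eulsum N f.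
Proof.
move=> sf; apply/eqP; rewrite -subr_eq opprK /eulsum -big_split /=.
rewrite (eq_bigr (fun n : 'I_N =>
   - (2^-1 ^+ n.+1 * altdiff n.+1 f - 2^-1 ^+ n * altdiff n f))); last first.
  by move=> n _; rewrite altdiffS !exprS; field.
rewrite sumrN -(big_mkord xpredT (fun n => 2^-1 ^+ n.+1 * altdiff n.+1 f - 2^-1 ^+ n * altdiff n f)).
rewrite (telescope_sumr (fun n => 2^-1 ^+ n * altdiff n f))// altdiff_eq0// mulr0.
by rewrite sub0r opprK expr0 mul1r /altdiff big_ord1 expr0 bin0 !mul1r.
Qed.

(** f(2z) *)
Definition fps_dil (f : fps K) : fps K := fun n => 2 ^+ n * f n.

Lemma fps_dilM f g : fps_dil (f * g) = fps_dil f * fps_dil g.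
Proof.
apply/funext => n; rewrite /fps_dil !fps_mulE /ps_mul mulr_sumr.
apply: eq_bigr => -[i /=]; rewrite ltnS => i_n _.
by rewrite -{1}(subnKC i_n) exprD; ring.
Qed.

Lemma fps_dilB f g : fps_dil (f - g) = fps_dil f - fps_dil g.
Proof. by apply/funext => n; rewrite !fpsBE /fps_dil fpsBE mulrBr. Qed.

Lemma fps_dil1 : fps_dil 1 = 1.
Proof.
apply/funext => -[|n]; rewrite /fps_dil !fps1E ?mulr0//.
by rewrite expr0 mul1r.
Qed.

Lemma fps_dilX : fps_dil (fps_X K) = fps_X K + fps_X K.
Proof.
apply/funext => n; rewrite /fps_dil fpsDE /fps_X.
by have [->|] := eqVneq n 1%N; rewrite ?mulr0 ?addr0// mulr1 expr1.
Qed.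

Lemma fps_dil_exp c : fps_dil (fexp c) = fexp (c + c).
Proof.
apply/funext => n; rewrite /fps_dil /fexp /ps_exp.
have -> : c + c = 2 * c by ring.
by rewrite exprMn mulrA.
Qed.

(** The coefficients of e^z / (e^z + 1), that is, the values at -j of the
    Dirichlet eta function divided by j! *)
Definition eta_neg : fps K := fun j => (2 ^+ j.+1 - 1) * bern K j.+1.

Lemma eta_negE : eta_neg * (fexp 1 + 1) = fexp 1.
Proof.
have XE : fps_X K * eta_neg = fps_dil (bern K) - bern K.
  apply/funext => -[|n]; rewrite fpsBE /fps_dil.
    by rewrite fps_mulX0 expr0 mul1r subrr.
  by rewrite fps_mulXS /eta_neg mulrBl mul1r.
have be := bern_exp K.
have db : fps_dil (bern K) * (fexp (1 + 1) - 1) =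
   (fps_X K + fps_X K) * fexp (1 + 1).
  rewrite -fps_dil_exp -[X in _ - X]fps_dil1 -fps_dilB -fps_dilM be fps_dilM.
  by rewrite fps_dilX.
rewrite -!fexpD in db.
(* One factor z comes from [XE], the other from cancelling e^z - 1. *)
apply: (@fps_mulXI K); apply: (@fps_mulXI K).
have e1 : fexp (-1) * fexp 1 = 1 :> fps K by rewrite fexpD addNr fexp0.
have key : (fps_X K * eta_neg) * (fexp 1 + 1) * (fexp 1 - 1) = fps_X K * fexp 1 * (fexp 1 - 1).
  rewrite XE.
  transitivity (fps_dil (bern K) * (fexp 1 * fexp 1 - 1) - bern K * (fexp 1 - 1) * (fexp 1 + 1)).
    by ring.
  by rewrite db be; ring.
have eX : fexp 1 - 1 = fexp 1 * (fps_X K * exp_quot K).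
  by rewrite exp_quotE mulrBr mulr1 fexpD subrr fexp0.
have bt := exp_quot_bern K.
have := congr1 (fun u => u * (fexp (-1) * bern K)) key.
rewrite eX; move: e1 bt; move: (fexp 1) (fexp (-1)) (fps_X K) (exp_quot K) (bern K) eta_neg.
move=> e e' X t b c e1 bt /= k.
transitivity (X * c * (e + 1) * (e * (X * t)) * (e' * b)).
  transitivity (X * (X * (c * (e + 1))) * (e' * e) * (t * b)); last by ring.
  by rewrite e1 bt !mulr1.
rewrite k; transitivity (X * (X * e) * (e' * e) * (t * b)); first by ring.
by rewrite e1 bt !mulr1.
Qed.

(** Both sides satisfy u_j + sum_(i<=j) C(j,i) u_i = 1. *)
Lemma eulsumXn N j : (j < N)%N -> eulsum N 'X^j = (1 - 2 ^+ j.+1) * zeta_neg K j.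
Proof.
have eD f g : eulsum N (f + g) = eulsum N f + eulsum N g.
  by rewrite /eulsum -big_split; apply: eq_bigr => n _ /=; rewrite altdiffD mulrDr.
have e0 : eulsum N 0 = 0.
  by rewrite /eulsum big1// => n _; rewrite altdiff0 mulr0.
have eZ c f : eulsum N (c *: f) = c * eulsum N f.
  rewrite /eulsum mulr_sumr; apply: eq_bigr => n _ /=; rewrite altdiffZ; ring.
have bE i : (1 - 2 ^+ i.+1) * zeta_neg K i = i`!%:R * eta_neg i.
  by rewrite /zeta_neg /eta_neg; ring.
elim/ltn_ind: j => j IH jN; rewrite bE.
have sj : (size ('X^j : {poly K})%R <= N)%N by rewrite size_polyXn.
have := eulsum_shift sj.
rewrite comp_Xn_poly expXD1 (big_morph _ eD e0) hornerXn expr1n.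
rewrite (eq_bigr (fun i : 'I_j.+1 => 'C(j, i)%:R * eulsum N 'X^i)); last first.
  by move=> i _; rewrite -scaler_nat eZ.
rewrite big_ord_recr /= binn mul1r.
rewrite (eq_bigr (fun i : 'I_j => j`!%:R * (eta_neg i / (j - i)`!%:R))); last first.
  move=> i _; rewrite IH// ?(ltn_trans (ltn_ord i))// bE mulr_natl binom_fact//.
  exact: ltnW.
rewrite -mulr_sumr => e.
have := congr1 (fun f : fps K => f j) eta_negE.
rewrite mulrDr mulr1 /= fpsDE fps_mulE /ps_mul /fexp /ps_exp big_ord_recr /=.
rewrite subnn expr1n fact0 divr1 mulr1 expr1n.
rewrite (eq_bigr (fun i : 'I_j => eta_neg i / (j - i)`!%:R)); last first.
  by move=> i _; rewrite expr1n mul1r.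
move=> e2; have := congr1 (fun x => j`!%:R * x) e2.
rewrite /= mul1r mulfV// => e3; move: e e3.
move: (\sum_(i < j) _) (eulsum _ _) => s u e e3.
have n2 : (2 : K) != 0 by rewrite pnatr_eq0.
apply: (mulfI n2).
have -> : 2 * u = 1 - j`!%:R * s.
  have e' : 1 = j`!%:R * s + u + u by rewrite e subrK.
  by transitivity (j`!%:R * s + u + u - j`!%:R * s); [ring|rewrite -e'].
by transitivity (j`!%:R * (s + eta_neg j + eta_neg j) - j`!%:R * s); [rewrite e3|ring].
Qed.

End HasseSondow.

Lemma eulsumXn_rmorph (F K : numFieldType) (phi : {rmorphism F -> K}) N j :
  phi (eulsum N 'X^j) = eulsum N 'X^j.
Proof.
rewrite /eulsum rmorph_sum; apply: eq_bigr => n _.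
rewrite rmorphM rmorphXn fmorphV rmorph_nat; congr (_ * _).
rewrite /altdiff rmorph_sum; apply: eq_bigr => k _ /=.
by rewrite !rmorphM rmorphXn rmorphN1 rmorph_nat !hornerXn rmorphXn rmorph_nat.
Qed.

(** The partial sums of the series that defines [zeta] are those of the Euler
    transform of X^(2r+1), hence eventually constant. *)
Lemma zeta_odd (R : realType) r :
  (zeta (- 1 - (2 * r)%:R : R))%:C%C = zeta_neg (R[i] : numFieldType) (2 * r).+1.
Proof.
set j := (2 * r).+1.
have sE : - (- 1 - (2 * r)%:R) = j%:R :> R by rewrite opprB opprK natr1.
have s1E : 1 - (- 1 - (2 * r)%:R) = j.+1%:R :> R by rewrite sE nat1r.
have limE : limn (series (fun n : nat => 2 ^- n.+1 *
   \sum_(k < n.+1) (-1) ^+ k * 'C(n, k)%:R * (k.+1)%:R `^ (j%:R))) = eulsum j.+1 'X^j :> R.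
  apply/cvg_lim => //; apply: cvg_near_cst; exists j.+1 => // n /= jn.
  rewrite (eulsumXn _ (ltnSn j)) -(eulsumXn _ jn) /series /= big_mkord.
  apply: eq_bigr => k _; rewrite exprVn; congr (_ * _); apply: eq_bigr => i _.
  by rewrite hornerXn powR_mulrn.
rewrite /zeta s1E sE limE powR_mulrn//.
have n0 : 1 - 2 ^+ j.+1 != 0 :> R[i].
  rewrite subr_eq0 eq_sym -natrX -[1]/(1%:R) eqr_nat.
  by rewrite neq_ltn [X in _ || X](_ : _ = true) ?orbT// -{1}(exp1n j.+1) ltn_exp2r.
rewrite -[(_)%:C%C]/(real_complex R _) rmorphM fmorphV rmorphB rmorph1 rmorphXn rmorph_nat.
by rewrite eulsumXn_rmorph eulsumXn// mulKf.
Qed.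

(** * The constant terms of the operators *)

Section Constants.
Variables (K : numFieldType) (h : vectType K) (nu : 'End(h)) (p : nat) (w : K).

Let f0 := natr_fact_neq0 K.

(** The coefficient of y1^r y2^r in the y1-derivative of H(y1-y2) is that of
    z^(2r+1) in H, up to (2r+1)! / (r!)^2 and a sign. *)
Lemma corrE (f : fps K) r :
  (r`! * r`!)%:R * corr f r%:Z r =
  - 2^-1 * (-1) ^+ r * ((2 * r).+1)`!%:R * (f * bern K) (2 * r).+2.
Proof.
rewrite /corr /deriv_y1 /subst_y1my2.
have -> : r%:Z + 1 + r%:Z = ((2 * r).+1)%:Z by lia.
have -> : r%:Z + 1 = r.+1%:Z by lia.
rewrite /div_1mexp.
have -> : ((2 * r).+1)%:Z + 1 = ((2 * r).+2)%:Z by lia.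
rewrite -/(exp_quot K) -/(bern K) -fps_mulE.
have -> : gbin K (2 * r).+1%:Z r = ((2 * r).+1)`!%:R / (r.+1`!%:R * r`!%:R).
  rewrite /gbin; have diffop_act : (r <= (2 * r).+1)%N by lia.
  have := ffact_fact diffop_act; have -> : ((2 * r).+1 - r = r.+1)%N by lia.
  move=> <-; rewrite natrM ffact_prod natr_prod.
  rewrite (eq_bigr (fun i : 'I_r => ((2 * r).+1 - i)%:R)); last first.
    move=> i _; rewrite [RHS]pmulrn; congr (_%:~R).
    by have := ltn_ord i; lia.
  have := f0 r; have := f0 r.+1; move: (\prod_(i < r) _) (_`!%:R) (_`!%:R) => x u v u0 v0.
  by field; rewrite u0 v0.
rewrite factS !natrM -?pmulrn.
have : r.+1%:R != 0 :> K by rewrite pnatr_eq0.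
have := f0 r; move: (r`!%:R) (r.+1%:R) => x y x0 y0.
by field; rewrite x0 y0.
Qed.

Lemma corr_num_z r :
  (r`! * r`!)%:R * corr (num_z nu p w) r%:Z r =
  - 2^-1 * (-1) ^+ r *
    \sum_(k < p) (\dim (eigsp nu w k%:Z))%:R * (Pmon K (2 * r).+1).[k%:R / p%:R].
Proof.
rewrite corrE -!mulrA; congr (_ * (_ * _)).
have -> : ((num_z nu p w : fps K) * bern K) (2 * r).+2 =
  \sum_(k < p) (\dim (eigsp nu w k%:Z))%:R *
    ((fexp (- (k%:R / p%:R)) - 1) * bern K) (2 * r).+2.
  rewrite fps_mulE /ps_mul /num_z.
  under eq_bigr do rewrite mulr_suml.
  rewrite exchange_big; apply: eq_bigr => k _ /=.
  rewrite fps_mulE /ps_mul mulr_sumr; apply: eq_bigr => i _.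
  by rewrite fpsBE fps1E /fexp; ring.
rewrite mulr_sumr; apply: eq_bigr => k _.
rewrite Pmon_horner mulrCA; congr (_ * _).
by rewrite !exprS mulN1r mulN1r opprK exprM sqrrN !expr1n mul1r.
Qed.

(** A constant power series *)
Definition fps_const (s : K) : fps K := fun n => s * (n == 0%N)%:R.

Lemma fps_constM s (f : fps K) n : (fps_const s * f) n = s * f n.
Proof.
rewrite fps_mulE /ps_mul big_ord_recl /fps_const /= mulr1 subn0 big1 ?addr0// => i _.
by rewrite mulr0 mul0r.
Qed.

Lemma corr_numbar_z r :
  (r`! * r`!)%:R * corr (numbar_z nu p w) r%:Z r =
  (r`! * r`!)%:R * corr (num_z nu p w) r%:Z r +
  (-1) ^+ r / 2 * zeta_neg K (2 * r).+1 *
    \sum_(k < p) (\dim (eigsp nu w k%:Z))%:R.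
Proof.
have -> : numbar_z nu p w = (num_z nu p w : fps K) +
   fps_const (\sum_(k < p) (\dim (eigsp nu w k%:Z))%:R).
  apply/funext => n; rewrite fpsDE /fps_const /numbar_z /num_z mulr_suml -big_split.
  by apply: eq_bigr => k _ /=; ring.
rewrite !corrE mulrDl fpsDE mulrDr fps_constM; congr (_ + _).
by rewrite /zeta_neg; field.
Qed.

Lemma pole0 d r : pole K d r%:Z r = 0.
Proof. by rewrite /pole /subst_y1my2 (_ : (_ == _) = false) ?mul0r ?mulr0. Qed.

End Constants.

(** * A Lie algebra of differential operators that contains D^+ *)

Section DiffopAlgebra.
Variable K : numFieldType.
Implicit Types (a b c : diffop K) (f g : {poly K}) (m n k : int).

Local Notation sh n := ('X + (n%:~R)%:P).

Lemma diffop_linE (x : K) a b k : (x *: a + b) k = x *: a k + b k.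
Proof. by []. Qed.
Lemma diffopZE (x : K) a k : (x *: a) k = x *: a k.
Proof. by []. Qed.
Lemma diffopBE a b k : (a - b) k = a k - b k.
Proof. by []. Qed.

Lemma tmon_lin n (x : K) f g :
  tmon n (x *: f + g) = x *: tmon n f + tmon n g :> diffop K.
Proof.
apply/funext => k; rewrite diffop_linE /tmon.
by case: ifP => // _; rewrite scaler0 addr0.
Qed.

Lemma dmul_fsupp a b k : fsupp a ->
  fsupp (fun m => (a m \Po sh (k - m)) * b (k - m)).
Proof. by move=> [r ar]; exists r => m /ar ->; rewrite comp_poly0 mul0r. Qed.

Lemma dmul_tmon m n f g :
  dmul (tmon m f) (tmon n g) = tmon (m + n) ((f \Po sh n) * g).
Proof.
apply/funext => k; rewrite /dmul (@fsum1 _ _ m) /tmon; last first.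
  by move=> i /negPf ->; rewrite comp_poly0 mul0r.
rewrite eqxx; have -> : (k - m == n) = (k == m + n) by apply/eqP/eqP; lia.
by case: eqP => [->|_]; rewrite ?mulr0// [m + n]addrC addrK.
Qed.

Lemma fsupp_lin (x : K) a b : fsupp a -> fsupp b -> fsupp (x *: a + b).
Proof.
move=> sa sb; have [r [ar br]] := fsupp_cat sa sb; exists r => k kr.
by rewrite diffop_linE ar// br// scaler0 addr0.
Qed.

Lemma dmul_linl (x : K) a b c : fsupp a -> fsupp b ->
  dmul (x *: a + b) c = x *: dmul a c + dmul b c.
Proof.
move=> sa sb; apply/funext => k.
rewrite diffop_linE /dmul.
rewrite fsumZ; last exact: dmul_fsupp.
rewrite -fsumD; last exact: dmul_fsupp.
  apply: fsumT_ext => m; rewrite diffop_linE.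
  by rewrite comp_polyD comp_polyZ mulrDl scalerAl.
have [r h] := dmul_fsupp c k sa.
by exists r => m /h ->; rewrite scaler0.
Qed.

Lemma dmul_linr (x : K) a b c : fsupp c ->
  dmul c (x *: a + b) = x *: dmul c a + dmul c b.
Proof.
move=> sc; apply/funext => k.
rewrite diffop_linE /dmul.
rewrite fsumZ; last exact: dmul_fsupp.
rewrite -fsumD; last exact: dmul_fsupp.
  apply: fsumT_ext => m; rewrite diffop_linE.
  by rewrite mulrDr scalerAr.
have [r h] := dmul_fsupp a k sc.
by exists r => m /h ->; rewrite scaler0.
Qed.

Lemma dbrC a b : dbr a b = - dbr b a.
Proof. by rewrite /dbr opprB. Qed.

Lemma dbr_linl (x : K) a b c : fsupp a -> fsupp b -> fsupp c ->
  dbr (x *: a + b) c = x *: dbr a c + dbr b c.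
Proof.
move=> sa sb sc; rewrite /dbr dmul_linl// dmul_linr// scalerBr.
by rewrite opprD addrACA.
Qed.

Lemma dbr_tmon m n f g : dbr (tmon m f) (tmon n g) =
  tmon (m + n) ((f \Po sh n) * g - (g \Po sh m) * f).
Proof.
rewrite /dbr !dmul_tmon [n + m]addrC; apply/funext => k.
rewrite diffopBE /tmon.
by case: ifP => // _; rewrite subr0.
Qed.

Lemma tmon_fsupp n f : fsupp (tmon n f : diffop K).
Proof. by exists [:: n] => k; rewrite inE /tmon => /negPf ->. Qed.

Lemma psi0_0l (m : nat) g : psi0 m 0 g = 0 :> K.
Proof. by rewrite /psi0 big1// => i _; rewrite horner0 mul0r. Qed.
Lemma psi0_0r (m : nat) f : psi0 m f 0 = 0 :> K.
Proof. by rewrite /psi0 big1// => i _; rewrite horner0 mulr0. Qed.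

Lemma psi_fsupp a b : fsupp a ->
  fsupp (fun m : nat => psi0 m (a m%:Z) (b (- m%:Z)) - psi0 m (b m%:Z) (a (- m%:Z))).
Proof.
move=> [r ar]; exists [seq `|k|%N | k <- r] => m mr.
have ar' (k : int) : `|k|%N = m -> a k = 0.
  by move=> km; apply: ar; apply: contra mr => kr; apply/mapP; exists k.
by rewrite !ar' ?absz_nat ?abszN// psi0_0l psi0_0r subr0.
Qed.

Lemma psiC a b : fsupp a -> psi a b = - psi b a.
Proof.
move=> sa; rewrite -[LHS]opprK; congr (- _); rewrite /psi fsumN; last exact: psi_fsupp.
by apply: fsumT_ext => m; rewrite opprB.
Qed.

Lemma psi_linl (x : K) a b c : fsupp a -> fsupp b ->
  psi (x *: a + b) c = x * psi a c + psi b c.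
Proof.
move=> sa sb; rewrite /psi mulr_fsumr -fsumD; last exact: psi_fsupp.
  apply: fsumT_ext => m; rewrite !diffop_linE /psi0.
  rewrite -!sumrB mulr_sumr -big_split; apply: eq_bigr => i _ /=.
  by rewrite !hornerD !hornerZ; ring.
have [r h] := psi_fsupp c sa.
by exists r => m /h ->; rewrite mulr0.
Qed.

Lemma psi_tmon (m : nat) n f g :
  psi (tmon m%:Z f) (tmon n g) = (m%:Z + n == 0)%:R * psi0 m f g.
Proof.
rewrite /psi (@fsum1 _ _ m).
  have [->|m0] := posnP m; first by rewrite /psi0 !big_geq// subr0 mulr0.
  rewrite /tmon eqxx [- m%:Z == m%:Z](_ : _ = false); last by apply/eqP; lia.
  rewrite psi0_0r subr0.
  have -> : (- m%:Z == n) = (m%:Z + n == 0) by apply/eqP/eqP; lia.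
  by case: eqP => _; rewrite ?mul1r// mul0r psi0_0r.
move=> k km; rewrite /tmon [k%:Z == m%:Z](_ : _ = false); last by apply/eqP; move/eqP: km; lia.
rewrite psi0_0l sub0r; case: (eqVneq (- k%:Z) m%:Z) => [km'|_]; last by rewrite psi0_0r oppr0.
by rewrite (_ : k = 0%N) ?/psi0 ?big_geq ?oppr0//; lia.
Qed.

Lemma psi_tmon0 m n f g : m + n != 0 -> psi (tmon m f) (tmon n g) = 0.
Proof.
move=> mn; rewrite /psi fsbig1// => k _; rewrite /tmon.
case: (eqVneq k%:Z m) => km; case: (eqVneq (- k%:Z) n) => kn;
  case: (eqVneq (- k%:Z) m) => km'; case: (eqVneq k%:Z n) => kn';
  rewrite ?(psi0_0l, psi0_0r) ?subr0//; move/eqP: mn; lia.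
Qed.

(** A symmetry condition satisfied by the f for which t^n f(D) lies in D^+: for
    f = X g it says that g is invariant under X |-> -X-n. *)
Definition sym (n : int) (f : {poly K}) :=
  forall x : K, (x + n%:~R) * f.[x] + x * f.[- x - n%:~R] = 0.

(** If n is not 0, this is the condition at x = 0; if n = 0, the condition makes f
    an odd polynomial. *)
Lemma sym_horner0 n f : sym n f -> f.[0] = 0.
Proof.
move=> fs; have [n0|nn0] := eqVneq n 0; last first.
  have /eqP := fs 0; rewrite mul0r addr0 add0r mulf_eq0 intr_eq0 (negPf nn0).
  by move=> /eqP.
have /(congr1 (fun q => q.[0])) : f + (f \Po (- 'X)) = 0.
  suff /eqP : 'X * (f + (f \Po (- 'X))) = 0 by rewrite mulf_eq0 polyX_eq0 => /eqP.
  apply: poly_natroots => x; have := fs x%:R; rewrite n0 addr0 subr0 => fsx.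
  by rewrite !(hornerE, horner_comp) mulrDr.
rewrite !(hornerE, horner_comp) oppr0 => f0.
by have /eqP := f0; rewrite -mulr2n mulrn_eq0 => /eqP.
Qed.

Lemma sym_rev n f x : sym n f -> (n%:~R - x) * f.[- x] = x * f.[x - n%:~R].
Proof.
by move=> /(_ (- x)); rewrite opprK mulNr => /eqP; rewrite subr_eq0 [- x + _]addrC => /eqP.
Qed.

Lemma sym_lin n (x : K) f g : sym n f -> sym n g -> sym n (x *: f + g).
Proof.
move=> fs gs y; rewrite !hornerD !hornerZ.
by transitivity (x * 0 + 0 : K); [rewrite -{1}(fs y) -(gs y); ring|rewrite mulr0 addr0].
Qed.

Lemma sym_bracket m n f g : sym m f -> sym n g ->
  sym (m + n) ((f \Po sh n) * g - (g \Po sh m) * f).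
Proof.
move=> fs gs x; rewrite !(hornerD, hornerN, hornerM, horner_shift) rmorphD /=.
set u := m%:~R; set v := n%:~R.
have := fs (x + v); have := gs (x + u); have := fs x; have := gs x.
rewrite -/u -/v.
have -> : - (x + v) - u = - x - (u + v) by ring.
have -> : - (x + u) - v = - x - (u + v) by ring.
have -> : - x - (u + v) + v = - x - u by ring.
have -> : - x - (u + v) + u = - x - v by ring.
rewrite -[x + v + u]addrA -[x + u + v]addrA [v + u]addrC.
set w := - x - (u + v).
move: f.[x] f.[x + v] f.[- x - u] f.[w] => f1 f2 f3 f4.
move: g.[x] g.[x + u] g.[- x - v] g.[w] => g1 g2 g3 g4.
move=> e1 e2 e3 e4.
transitivity ((((x + (u + v)) * f2 + (x + v) * f4) * g1
   - ((x + v) * g1 + x * g3) * f4)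
   - (((x + (u + v)) * g2 + (x + u) * g4) * f1
   - ((x + u) * f1 + x * f3) * g4)); first by ring.
by rewrite e1 e2 e3 e4 !mul0r !subr0.
Qed.

Lemma sym0 n : sym n 0.
Proof. by move=> x; rewrite !horner0 !mulr0 addr0. Qed.

(** The finitely supported operators all of whose components satisfy the
    symmetry condition *)
Definition Dsym : set (diffop K) := [set a | fsupp a /\ forall n, sym n (a n)].

Lemma Dsym_lin (x : K) a b : Dsym a -> Dsym b -> Dsym (x *: a + b).
Proof.
move=> [sa ha] [sb hb]; split; first exact: fsupp_lin.
by move=> n; rewrite diffop_linE; exact: sym_lin.
Qed.

Lemma Dsym0 : Dsym 0.
Proof. by split; [exists [::]|move=> n; exact: sym0]. Qed.

Lemma Dsym_tmon n f : sym n f -> Dsym (tmon n f).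
Proof.
move=> fs; split; first exact: tmon_fsupp.
by move=> k; rewrite /tmon; case: eqP => [->|_] //; exact: sym0.
Qed.

(** To prove P on this algebra, it suffices to treat the homogeneous operators and
    their sums. *)
Lemma Dsym_ind (P : diffop K -> Prop) :
  P 0 ->
  (forall n f a, sym n f -> Dsym a -> P (tmon n f) -> P a -> P (tmon n f + a)) ->
  (forall n f, sym n f -> P (tmon n f)) ->
  forall a, Dsym a -> P a.
Proof.
move=> P0 PD Pt a [[r ar] ha].
have -> : a = \sum_(n <- undup r) tmon n (a n).
  apply/funext => k; rewrite (big_morph (fun b : diffop K => b k) (id1 := 0) (op1 := +%R)) //.
  have [kr|kr] := boolP (k \in undup r).
    rewrite (bigD1_seq k) ?undup_uniq//= /tmon eqxx big1 ?addr0// => i ik.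
    by rewrite eq_sym (negPf ik).
  rewrite ar ?big_seq ?big1//; last by rewrite -mem_undup.
  by move=> i ir; rewrite /tmon; case: eqP => // ki; rewrite ki ir in kr.
suff : Dsym (\sum_(n <- undup r) tmon n (a n)) /\ P (\sum_(n <- undup r) tmon n (a n)).
  by case.
elim: (undup r) => [|n s [IH1 IH2]]; first by rewrite big_nil; split; [exact: Dsym0|].
rewrite big_cons; split; last by apply: PD => //; exact: Pt.
by rewrite -[tmon _ _]scale1r; apply: Dsym_lin => //; exact: Dsym_tmon.
Qed.

Lemma dbr_linr (x : K) a b c : fsupp a -> fsupp b -> fsupp c ->
  dbr c (x *: a + b) = x *: dbr c a + dbr c b.
Proof.
move=> sa sb sc; rewrite dbrC dbr_linl// opprD -scalerN.
by rewrite -[- dbr a c]dbrC -[- dbr b c]dbrC.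
Qed.

Lemma dbr0l b : dbr 0 b = 0.
Proof.
apply/funext => k; rewrite /dbr diffopBE /dmul !fsbig1 ?subr0// => m _.
  by rewrite mulr0.
by rewrite comp_poly0 mul0r.
Qed.

Lemma Dsym_dbr a b : Dsym a -> Dsym b -> Dsym (dbr a b).
Proof.
move=> ha hb; move: a ha; apply: Dsym_ind.
- by rewrite dbr0l; exact: Dsym0.
- move=> n f a fs ha h1 h2; rewrite -[tmon _ _]scale1r dbr_linl; last 3 first.
  + exact: tmon_fsupp.
  + by case: ha.
  + by case: hb.
  exact: Dsym_lin.
- move=> m f fs; move: b hb; apply: Dsym_ind.
  + by rewrite dbrC dbr0l oppr0; exact: Dsym0.
  + move=> n g a gs ha h1 h2; rewrite -[tmon n _]scale1r dbr_linr; last 3 first.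
    * exact: tmon_fsupp.
    * by case: ha.
    * exact: tmon_fsupp.
    exact: Dsym_lin.
  + by move=> n g gs; rewrite dbr_tmon; apply: Dsym_tmon; exact: sym_bracket.
Qed.

(** The polynomial f such that L_n^(r) = t^n f(D) *)
Definition Lpoly n r : {poly K} := (-1) ^+ r.+1 *: (sh n ^+ r * 'X^(r.+1)).

Lemma LgenE n r : Lgen K n r = tmon n (Lpoly n r).
Proof.
rewrite /Lgen !dmul_tmon addr0 add0r comp_Xn_poly comp_polyX.
apply/funext => k; rewrite diffopZE /tmon /Lpoly.
case: ifP => _; last by rewrite scaler0.
by rewrite mulr0z addr0 ['X^(r.+1)]exprS.
Qed.

Lemma Lpoly_horner n r x : (Lpoly n r).[x] = (-1) ^+ r.+1 * ((x + n%:~R) ^+ r * x ^+ r.+1).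
Proof. by rewrite hornerZ hornerM hornerXn horner_exp hornerD hornerX hornerC. Qed.

Lemma Lpoly_sym n r : sym n (Lpoly n r).
Proof.
move=> x; rewrite !Lpoly_horner subrK -opprD [(- x) ^+ r]exprNn [(- (x + _)) ^+ _]exprNn.
have e : (-1) ^+ r * (-1) ^+ r = 1 :> K by rewrite -expr2 sqrr_sign.
rewrite !exprS; move: ((-1) ^+ r) ((x + n%:~R) ^+ r) (x ^+ r) e => s y z e.
by transitivity ((1 - s * s) * (s * (-1) * (x + n%:~R) * y * x * z)); [ring|rewrite e subrr mul0r].
Qed.

Lemma Dplus_sub : @Dplus K `<=` Dsym.
Proof.
move=> a; apply; [exact: Dsym0|exact: Dsym_lin|exact: Dsym_dbr|].
by move=> _ [n [r ->]]; rewrite LgenE; apply: Dsym_tmon; exact: Lpoly_sym.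
Qed.

End DiffopAlgebra.

(** * Quadratic operators in the modes *)

(** The properties of the modes of an orthonormal basis on which the
    representation depends: [a q k] is the mode alpha_q(k/p), the matrix [E k]
    is that of the projection on an eigenspace, and [D k] is its trace. *)
Section Heisenberg.
Variables (K : numFieldType) (S : lmodType K) (p d : nat).
Variables (a : 'I_d -> int -> S -> S) (E : int -> 'I_d -> 'I_d -> K).
Variable D : int -> K.
Hypothesis p_gt0 : (0 < p)%N.

(** The index of a mode, as a number *)
Definition kap (k : int) : K := k%:~R / p%:R.

Hypothesis a_lin : forall q k, linear (a q k).
Hypothesis a_comm : forall q k q' l v,
  a q k (a q' l v) - a q' l (a q k v) = ((k + l == 0)%:R * kap k * E k q q') *: v.
Hypothesis E_contr : forall (k : int) q' (j : int) v, (p %| j + k)%Z ->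
  \sum_(q < d) E k q q' *: a q j v = a q' j v.
Hypothesis E_tr : forall k, \sum_(q < d) E k q q = D k.
Hypothesis D_per : forall (k m : int), D (k + p%:Z * m) = D k.
Hypothesis D_opp : forall k : int, D (- k) = D k.
Hypothesis a0 : forall q v, a q 0 v = 0.
Hypothesis a_bd : forall v, exists M : nat, forall q (k : int), M%:Z <= k -> a q k v = 0.

Let pn0 : p%:R != 0 :> K. Proof. by rewrite pnatr_eq0 -lt0n. Qed.

Lemma kapD k l : kap (k + l) = kap k + kap l.
Proof. by rewrite /kap rmorphD /= mulrDl. Qed.
Lemma kapN k : kap (- k) = - kap k.
Proof. by rewrite /kap rmorphN /= mulNr. Qed.
Lemma kapB k l : kap (k - l) = kap k - kap l.
Proof. by rewrite kapD kapN. Qed.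
Lemma kap_mul n : kap (p%:Z * n) = n%:~R.
Proof. by rewrite /kap rmorphM /= mulrC mulKf. Qed.
Lemma kap_eq0 k : (kap k == 0) = (k == 0).
Proof. by rewrite /kap mulf_eq0 invr_eq0 (negPf pn0) orbF intr_eq0. Qed.
Lemma kap0 : kap 0 = 0. Proof. by apply/eqP; rewrite kap_eq0. Qed.

Lemma aD q k x y : a q k (x + y) = a q k x + a q k y.
Proof. by have := a_lin q k 1 x y; rewrite !scale1r. Qed.
Lemma a_0 q k : a q k 0 = 0.
Proof. by apply: addr_idem; rewrite -aD addr0. Qed.
Lemma aZ q k c x : a q k (c *: x) = c *: a q k x.
Proof. by have := a_lin q k c x 0; rewrite a_0 !addr0. Qed.
Lemma aN q k x : a q k (- x) = - a q k x.
Proof. by rewrite -scaleN1r aZ scaleN1r. Qed.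
Lemma aB q k x y : a q k (x - y) = a q k x - a q k y.
Proof. by rewrite aD aN. Qed.

(** :alpha_q(k/p) alpha_q(l/p): *)
Definition npair q k l v := if 0 < k then a q l (a q k v) else a q k (a q l v).

(** The sum over q of the normally ordered products *)
Definition npairs (k l : int) v := \sum_(q < d) npair q k l v.

Lemma npairs_lin k l c x y : npairs k l (c *: x + y) = c *: npairs k l x + npairs k l y.
Proof.
rewrite /npairs scaler_sumr -big_split; apply: eq_bigr => q _.
by rewrite /npair /=; case: ifP => _; rewrite !aD !aZ.
Qed.

(** The same sum without normal ordering *)
Definition plain (k l : int) v := \sum_(q < d) a q k (a q l v).

Lemma plainB k l v : plain k l v - plain l k v =
  ((k + l == 0)%:R * kap k * D k) *: v.
Proof.
rewrite /plain -sumrB -E_tr mulr_sumr scaler_suml.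
by apply: eq_bigr => q _; rewrite a_comm.
Qed.

Lemma npairsE k l v : npairs k l v = if 0 < k then plain l k v else plain k l v.
Proof. by rewrite /npairs /plain /npair; case: ifP. Qed.

Lemma plainE k l v : plain k l v =
  npairs k l v + (((0 < k) && (k + l == 0))%:R * kap k * D k) *: v.
Proof.
rewrite npairsE; case: ifP => k0 /=; last by rewrite !mul0r scale0r addr0.
by rewrite -plainB addrC subrK.
Qed.

Lemma npairs_sym k l v : npairs k l v = npairs l k v.
Proof.
rewrite !npairsE; case: ifP => k0; case: ifP => l0 //; apply/eqP.
  rewrite eq_sym -subr_eq0 plainB.
  have /negPf -> : k + l != 0 by lia.
  by rewrite !mul0r scale0r.
rewrite -subr_eq0 plainB; case: (eqVneq (k + l) 0) => [kl|_]; last by rewrite !mul0r scale0r.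
have -> : k = 0 by lia.
by rewrite kap0 mulr0 mul0r scale0r.
Qed.

Lemma npairs_mode k l q j v : (p %| k + l)%Z ->
  npairs k l (a q j v) - a q j (npairs k l v) =
  ((l + j == 0)%:R * kap l) *: a q k v + ((k + j == 0)%:R * kap k) *: a q l v.
Proof.
have gen k' l' : (p %| k' + l')%Z ->
  plain k' l' (a q j v) - a q j (plain k' l' v) =
  ((l' + j == 0)%:R * kap l') *: a q k' v + ((k' + j == 0)%:R * kap k') *: a q l' v.
  move=> pkl; rewrite /plain (big_morph _ (aD q j) (a_0 q j)) -sumrB.
  rewrite -[in RHS](E_contr _ _ pkl) -[a q l' v](@E_contr k'); last by rewrite addrC.
  rewrite !scaler_sumr -big_split; apply: eq_bigr => q' _ /=.
  rewrite !scalerA -(a_comm q' k' q j (a q' l' v)).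
  have := a_comm q' l' q j v => /(congr1 (a q' k')); rewrite aZ => <-.
  by rewrite aB addrA subrK.
move=> pkl; rewrite !npairsE; case: ifP => _; last exact: gen.
by rewrite gen 1?addrC// addrC.
Qed.

Lemma fsupp_box (F : int -> S) :
  (exists B : nat, forall k : int, (B < `|k|)%N -> F k = 0) -> fsupp F.
Proof.
move=> [B FB]; exists [seq i%:Z - B%:Z | i <- iota 0 (B + B).+1] => k kB.
apply: FB; rewrite ltnNge; apply: contra kB => kB.
apply/mapP; exists (absz (k + B%:Z)); first by rewrite mem_iota; lia.
lia.
Qed.

Lemma npairs_fsupp n v : fsupp (fun k => npairs k (p%:Z * n - k) v).
Proof.
apply: fsupp_box; have [M aM] := a_bd v.
exists (M + absz (p%:Z * n)%R)%N => k kM; apply: big1 => q _; rewrite /npair.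
case: ifP => k0; first by rewrite aM ?a_0//; lia.
by rewrite [a q (_ - k) v]aM ?a_0//; lia.
Qed.

(** The coefficient of the k-th product in the operator attached to t^n f(D).  For
    k = 0 it is the default value 0 of the division, but then the product itself
    vanishes. *)
Definition coef (f : {poly K}) k := f.[- kap k] / kap k.

(** The quadratic operator attached to t^n f(D) *)
Definition quadop (n : int) (f : {poly K}) v :=
  2^-1 *: \sum_(k \in [set: int]) coef f k *: npairs k (p%:Z * n - k) v.

Lemma scale_npairs_fsupp (c : int -> K) n v :
  fsupp (fun k => c k *: npairs k (p%:Z * n - k) v).
Proof.
apply: (fsupp_map (f := fun k => GRing.scale (c k))) (npairs_fsupp n v).
by move=> k; rewrite scaler0.
Qed.

Lemma quadop_lin n f c x y : quadop n f (c *: x + y) = c *: quadop n f x + quadop n f y.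
Proof.
rewrite /quadop scalerA [c * _]mulrC -scalerA -scalerDr; congr (_ *: _).
rewrite fsumZ; last exact: scale_npairs_fsupp.
rewrite -fsumD; last exact: scale_npairs_fsupp.
  by apply: fsumT_ext => k; rewrite npairs_lin scalerDr !scalerA mulrC.
apply: (fsupp_map (f := fun k => GRing.scale c)) (scale_npairs_fsupp _ _ _).
by move=> k; rewrite scaler0.
Qed.

Lemma quadopD n f x y : quadop n f (x + y) = quadop n f x + quadop n f y.
Proof. by have := quadop_lin n f 1 x y; rewrite !scale1r. Qed.
Lemma quadop0r n f : quadop n f 0 = 0.
Proof. by apply: addr_idem; rewrite -quadopD addr0. Qed.
Lemma quadopZ n f c x : quadop n f (c *: x) = c *: quadop n f x.
Proof. by have := quadop_lin n f c x 0; rewrite quadop0r !addr0. Qed.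

Lemma quadop_linl n c f g v : quadop n (c *: f + g) v = c *: quadop n f v + quadop n g v.
Proof.
rewrite /quadop scalerA [c * _]mulrC -scalerA -scalerDr; congr (_ *: _).
rewrite fsumZ; last exact: scale_npairs_fsupp.
rewrite -fsumD; last exact: scale_npairs_fsupp.
  apply: fsumT_ext => k; rewrite /coef scalerA -scalerDl; congr (_ *: _).
  by rewrite hornerD hornerZ mulrDl mulrA.
apply: (fsupp_map (f := fun k => GRing.scale c)) (scale_npairs_fsupp _ _ _).
by move=> k; rewrite scaler0.
Qed.

(** The operator attached to t^m f(D) acts on the modes as t^m f(D) acts on the
    powers of t. *)
Lemma quadop_mode m f q j v : sym m f ->
  quadop m f (a q j v) - a q j (quadop m f v) = f.[kap j] *: a q (j + p%:Z * m) v.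
Proof.
move=> fs; rewrite {1 2}/quadop aZ -scalerBr.
rewrite (fsum_morph (f := a q j)); last exact: scale_npairs_fsupp.
- have sG : fsupp (fun k : int => a q j (coef f k *: npairs k (p%:Z * m - k) v)).
    apply: (fsupp_map (f := fun _ => a q j)) (scale_npairs_fsupp _ _ _) => _.
    exact: a_0.
  rewrite fsumN// -fsumD; last first.
  + by apply: (fsupp_map (f := fun _ => @GRing.opp S)) sG => _; rewrite oppr0.
  + exact: scale_npairs_fsupp.
  pose G1 k := (coef f k * ((p%:Z * m - k + j == 0)%:R * kap (p%:Z * m - k)))
                  *: a q k v.
  pose G2 k := (coef f k * ((k + j == 0)%:R * kap k)) *: a q (p%:Z * m - k) v.
  have e1 k : k != p%:Z * m + j -> G1 k = 0.
    move=> kj; rewrite /G1 (_ : (_ == 0) = false) ?mul0r ?mulr0 ?scale0r//.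
    by apply/negbTE; apply: contra kj => /eqP h; apply/eqP; lia.
  have e2 k : k != - j -> G2 k = 0.
    move=> kj; rewrite /G2 (_ : (_ == 0) = false) ?mul0r ?mulr0 ?scale0r//.
    by apply/negbTE; apply: contra kj => /eqP h; apply/eqP; lia.
  rewrite (fsumT_ext (G := fun k => G1 k + G2 k)); last first.
    move=> k; rewrite aZ -scalerBr npairs_mode ?scalerDr ?scalerA//.
    by rewrite addrC subrK dvdz_mulr.
  rewrite fsumD; last 2 first.
  + by exists [:: p%:Z * m + j] => k; rewrite inE => /e1.
  + by exists [:: - j] => k; rewrite inE => /e2.
  (* Only the products of index pm + j and -j fail to commute with the mode. *)
  rewrite (fsum1 e1) (fsum1 e2) /G1 /G2.
  rewrite addNr eqxx opprD opprK !addrA subrr add0r !addNr eqxx !mul1r.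
  rewrite [p%:Z * m + j]addrC -scalerDl scalerA.
  have [jm|jm] := eqVneq (j + p%:Z * m) 0; first by rewrite jm a0 !scaler0.
  congr (_ *: _); rewrite /coef kapD kap_mul !kapN opprK.
  have kjm : kap j + m%:~R != 0 by rewrite -(kap_mul m) -kapD kap_eq0.
  have [->|j0] := eqVneq j 0; first by rewrite kap0 oppr0 !mulr0 (sym_horner0 fs) addr0 mulr0.
  have := fs (kap j); rewrite opprD.
  move: kjm; rewrite -kap_eq0 in j0; move: j0.
  move: (kap j) (m%:~R) => x y x0 xy fxy.
  have -> : f.[- x - y] = - (x + y) * f.[x] / x.
    have -> : - (x + y) * f.[x] = x * f.[- x - y].
      by apply/eqP; rewrite -subr_eq0 mulNr -opprD oppr_eq0 fxy.
    by rewrite mulrC mulKf.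
  by field; rewrite x0 xy.
- exact: a_0.
- exact: aD.
Qed.

Lemma quadop_plain m f k l v : sym m f ->
  quadop m f (plain k l v) - plain k l (quadop m f v) =
  f.[kap k] *: plain (k + p%:Z * m) l v + f.[kap l] *: plain k (l + p%:Z * m) v.
Proof.
move=> fs; rewrite /plain (big_morph _ (@quadopD m f) (@quadop0r m f)) -sumrB.
rewrite !scaler_sumr -big_split; apply: eq_bigr => q _ /=.
rewrite -(quadop_mode _ _ _ fs) -aZ -(quadop_mode _ _ _ fs) aB.
by rewrite addrA subrK.
Qed.

(** A normally ordered product leaves a scalar when one of its factors is moved
    across the degree 0, which for m >= 0 happens only to the indices k with
    -pm < k <= 0. *)
Lemma quadop_npairs m n f k v : sym m f -> (m + n = 0 -> 0 <= m) ->
  let l := p%:Z * n - k in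
  quadop m f (npairs k l v) - npairs k l (quadop m f v) =
  f.[kap l] *: npairs k (l + p%:Z * m) v + f.[kap k] *: npairs (k + p%:Z * m) l v +
  ([&& m + n == 0, k <= 0 & 0 < k + p%:Z * m]%:R
     * f.[kap k] * kap (k + p%:Z * m) * D k) *: v.
Proof.
move=> fs mn l.
have kl0 : (k + p%:Z * m + l == 0) = (m + n == 0).
  rewrite /l (_ : _ + l = p%:Z * (m + n)); last by rewrite /l; ring.
  by rewrite mulf_eq0 -[p%:Z == 0]/(p == 0)%N eqn0Ngt p_gt0.
have pm0 : 0 <= m -> 0 <= p%:Z * m by move=> ?; rewrite mulr_ge0.
have klm : l + p%:Z * m + k = k + p%:Z * m + l by ring.
rewrite [npairs k l v]npairsE [npairs k l (quadop m f v)]npairsE; have [k0|k0] /= := ltP 0 k.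
  rewrite andbF /= !mul0r scale0r addr0 quadop_plain//.
  have -> : plain (l + p%:Z * m) k v = npairs k (l + p%:Z * m) v.
    rewrite plainE klm kl0 npairs_sym (_ : _ && _ = false) ?mul0r ?scale0r ?addr0//.
    apply/negbTE/negP => /andP[l0 /eqP mn0].
    by move: kl0; rewrite mn0 eqxx => /eqP; lia.
  suff -> : plain l (k + p%:Z * m) v = npairs (k + p%:Z * m) l v by [].
  rewrite plainE [l + (k + _)]addrC kl0 npairs_sym (_ : _ && _ = false) ?mul0r ?scale0r ?addr0//.
  apply/negbTE/negP => /andP[l0 /eqP mn0].
  by have := pm0 (mn mn0); move: kl0; rewrite mn0 eqxx => /eqP; lia.
rewrite quadop_plain// addrC [plain k _ v]plainE ltNge k0 /= !mul0r scale0r addr0.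
rewrite plainE kl0 D_per scalerDr scalerA addrA [f.[kap l] *: _ + _]addrC.
congr (_ + _ *: _); rewrite [in RHS]andbC.
by ring.
Qed.

(** The case m + n = 0, m < 0 follows by antisymmetry. *)
Lemma quadop_bracket m n f g v : sym m f -> sym n g -> (m + n = 0 -> 0 <= m) ->
  quadop m f (quadop n g v) - quadop n g (quadop m f v) =
  quadop (m + n) ((f \Po ('X + n%:~R%:P)) * g - (g \Po ('X + m%:~R%:P)) * f) v
  - (2^-1 * (m + n == 0)%:R *
     \sum_(i < p * `|m|) f.[kap (- i.+1%:Z)] * g.[kap (- i.+1%:Z) + m%:~R] * D i.+1)
    *: v.
Proof.
move=> fs gs mn.
pose l k := p%:Z * n - k.
pose c k := ([&& m + n == 0, k <= 0 & 0 < k + p%:Z * m]%:R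
     * f.[kap k] * kap (k + p%:Z * m) * D k).
have -> : quadop m f (quadop n g v) - quadop n g (quadop m f v) = 2^-1 *: \sum_(k \in [set: int])
   (coef g k *: (quadop m f (npairs k (l k) v) - npairs k (l k) (quadop m f v))).
  rewrite {2 3}/quadop quadopZ -scalerBr (fsum_morph (f := quadop m f)) ?quadop0r//; last 2 first.
  - exact: quadopD.
  - exact: scale_npairs_fsupp.
  have sG : fsupp (fun k : int => quadop m f (coef g k *: npairs k (p%:Z * n - k) v)).
    apply: (fsupp_map (f := fun _ => quadop m f)) (scale_npairs_fsupp _ _ _) => _.
    exact: quadop0r.
  rewrite fsumN; last exact: scale_npairs_fsupp.
  rewrite -fsumD//.
    by congr (_ *: _); apply: fsumT_ext => k; rewrite quadopZ scalerBr.
  apply: (fsupp_map (f := fun _ => @GRing.opp S)) (scale_npairs_fsupp _ _ _) => _.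
  by rewrite oppr0.
pose G1 k := (coef g k * f.[kap (l k)]) *: npairs k (p%:Z * (m + n) - k) v.
pose G2 k := (coef g k * f.[kap k]) *: npairs (k + p%:Z * m) (l k) v.
pose G2' k := (coef g (k - p%:Z * m) * f.[kap (k - p%:Z * m)]) *: 
   npairs k (p%:Z * (m + n) - k) v.
have s1 : fsupp G1 by exact: scale_npairs_fsupp.
have s2' : fsupp G2' by exact: scale_npairs_fsupp.
have e2 k : G2 k = G2' (k + p%:Z * m).
  by rewrite /G2 /G2' addrK; congr (_ *: npairs _ _ _); rewrite /l; ring.
have s2 : fsupp G2.
  by have [r h] := fsupp_shift (p%:Z * m) s2'; exists r => k /h; rewrite e2.
pose G3 k := coef g k * c k.
have e3 (k : int) : k \notin [seq - i.+1%:Z | i <- iota 0 (p * `|m|)] -> G3 k = 0.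
  move=> kr; have [->|k0] := eqVneq k 0.
    by rewrite /G3 /coef kap0 invr0 mulr0 mul0r.
  rewrite /G3 /c (_ : [&& _, _ & _] = false) ?mul0r ?mulr0//.
  apply: contraNF kr => /and3P[/eqP mn0 kn kp]; apply/mapP.
  have m0 := mn mn0.
  exists `|k|.-1%N; last by lia.
  by rewrite mem_iota /=; nia.
have s3 : fsupp (fun k => G3 k *: v).
  by exists [seq - i.+1%:Z | i <- iota 0 (p * `|m|)] => k /e3 ->; rewrite scale0r.
rewrite (fsumT_ext (G := fun k => G1 k + G2 k + G3 k *: v)); last first.
  move=> k; rewrite (quadop_npairs _ _ fs mn) /G1 /G2 /G3 -/(c k) !scalerDr !scalerA.
  by congr (_ *: npairs _ _ _ + _ + _); rewrite /l; ring.
rewrite fsumD//; last exact: fsuppD.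
rewrite scalerDr; congr (_ + _).
  rewrite fsumD// (fsumT_ext e2) -(fsum_shift (p%:Z * m) G2') -fsumD//.
  rewrite /quadop; congr (_ *: _); apply: fsumT_ext => k.
  rewrite /G1 /G2' -scalerDl.
  have [->|k0] := eqVneq k 0.
    by rewrite /npairs !big1 ?scaler0// => q _; rewrite /npair ltxx a0.
  congr (_ *: _); rewrite /coef /l !hornerE !horner_comp !hornerE.
  rewrite !kapB !kap_mul opprB.
  rewrite -kap_eq0 in k0; move: (kap k) k0 => x x0.
  have [xm|xm] := eqVneq (x - m%:~R) 0.
    have /eqP -> : x == m%:~R by rewrite -subr_eq0 xm.
    rewrite subrr addNr invr0 (sym_horner0 gs) [- _ + n%:~R]addrC; ring.
  rewrite [- x + n%:~R]addrC [- x + m%:~R]addrC; have e := sym_rev x fs.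
  have -> : f.[x - m%:~R] = (m%:~R - x) * f.[- x] / x by rewrite e mulrC mulKf.
  by field; rewrite x0 xm.
rewrite -mulrA -scaleNr -mulrN -scalerA; congr (_ *: _).
rewrite (fsumE (r := [seq - i.+1%:Z | i <- iota 0 (p * `|m|)])); last first.
  by move=> k /e3 ->; rewrite scale0r.
rewrite undup_id; last by rewrite map_inj_uniq ?iota_uniq// => i j; lia.
rewrite big_map -scaler_suml; congr (_ *: v).
rewrite -[X in iota 0 X]subn0 big_mkord mulr_sumr -sumrN; apply: eq_bigr => i _.
rewrite /G3 /c; case: eqVneq => [mn0|_]; last by rewrite !mul0r mulr0 oppr0.
have m0 := mn mn0; rewrite /= mul1r.
have -> : D (- i.+1%:Z) = D i.+1 by rewrite D_opp.
have nE : n = - m by lia.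
move: (ltn_ord i) => im; set k := - i.+1%:Z.
rewrite !kapD kap_mul /coef.
have x0 : kap k != 0 by rewrite kap_eq0.
have gm : (kap k + m%:~R) * g.[- kap k] = - kap k * g.[kap k + m%:~R].
  have := sym_rev (kap k) gs; rewrite nE rmorphN /= opprK => e.
  by rewrite mulNr -e; ring.
have [kp|kp] := ltP 0 (k + p%:Z * m).
  rewrite /= mul1r.
  have -> : g.[kap k + m%:~R] = - ((kap k + m%:~R) * g.[- kap k] / kap k).
    by rewrite gm; field.
  by field.
rewrite /= !mul0r mulr0.
have -> : kap k + m%:~R = 0.
  by rewrite -(kap_mul m) -kapD; apply/eqP; rewrite kap_eq0; apply/eqP; nia.
by rewrite (sym_horner0 gs) mulr0 mul0r oppr0.
Qed.

Hypothesis D_sum : \sum_(k < p) D k%:Z = d%:R.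

(** The constant term attached to t^0 f(D) *)
Definition theta (f : {poly K}) : K :=
  2^-1 * \sum_(k < p) D k%:Z * (Psum f).[kap k%:Z].

Lemma theta_lin c f g : theta (c *: f + g) = c * theta f + theta g.
Proof.
rewrite /theta mulrCA -mulrDr; congr (_ * _); rewrite mulr_sumr -big_split.
by apply: eq_bigr => k _; rewrite PsumD PsumZ hornerD hornerZ /=; ring.
Qed.

Lemma theta0 : theta 0 = 0.
Proof.
by have := theta_lin 1 0 0; rewrite scale1r addr0 mul1r; exact: addr_idem.
Qed.

Lemma big_ord_mul (N M : nat) (G : nat -> K) :
  \sum_(i < N * M) G i = \sum_(j < M) \sum_(k < N) G (N * j + k)%N.
Proof.
elim: M => [|M IH]; first by rewrite muln0 !big_ord0.
rewrite mulnSr big_split_ord big_ord_recr /= IH; congr (_ + _).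
Qed.

(** The constant terms turn the scalar of [quadop_bracket] into the cocycle. *)
Lemma theta_bracket (m : nat) f g :
  theta ((f \Po ('X + (- m%:Z)%:~R%:P)) * g - (g \Po ('X + (m%:Z)%:~R%:P)) * f)
  - 2^-1 * psi0 m f g * d%:R =
  - (2^-1 * \sum_(i < p * m) f.[kap (- i.+1%:Z)] * g.[kap (- i.+1%:Z) + m%:R] * D i.+1).
Proof.
set F := (g \Po ('X + (m%:Z)%:~R%:P)) * f.
have -> : (f \Po ('X + (- m%:Z)%:~R%:P)) * g = F \Po ('X + (- m%:R)%:P).
  rewrite /F comp_polyM -comp_polyA comp_polyD comp_polyX comp_polyC.
  by rewrite rmorphN /= -addrA -polyCD addNr addr0 comp_polyXr mulrC.
have FE x : F.[x] = f.[x] * g.[x + m%:R].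
  by rewrite /F hornerM horner_shift mulrC.
rewrite /theta -[2^-1 * psi0 _ _ _ * _]mulrA -mulrBr -[RHS]mulrN; congr (_ * _).
have -> : psi0 m f g = \sum_(j < m) F.[- j.+1%:R].
  rewrite /psi0 big_add1 /= big_mkord; apply: eq_bigr => j _.
  by rewrite FE addrC.
rewrite -D_sum mulr_sumr -sumrB.
rewrite (eq_bigr (fun k : 'I_p => - \sum_(j < m) D k%:Z * F.[kap k%:Z - j.+1%:R])); last first.
  by move=> k _; rewrite Psum_telescope sumrB -mulr_sumr; ring.
(* The indices -pm <= -(i+1) < 0 are written k - p(j+1) with 0 <= k < p. *)
rewrite sumrN; congr (- _); rewrite (big_ord_mul p m
  (fun i => f.[kap (- i.+1%:Z)] * g.[kap (- i.+1%:Z) + m%:R] * D i.+1)).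
rewrite exchange_big; apply: eq_bigr => j _ /=.
rewrite (reindex_inj rev_ord_inj) /=; apply: eq_bigr => k _.
rewrite FE mulrC.
have e : (p - k.+1)%:Z = - (p * j + k).+1%:Z + p%:Z * j.+1%:Z :> int.
  by have := ltn_ord k; lia.
have -> : kap (p - k.+1)%:Z - j.+1%:R = kap (- (p * j + k).+1%:Z).
  by rewrite e kapD kap_mul addrK.
by rewrite e D_per D_opp.
Qed.

(** The operator on [S] by which a differential operator acts *)
Definition diffop_act (u : diffop K) v :=
  \sum_(n \in [set: int]) quadop n (u n) v + theta (u 0) *: v.

Lemma quadop0l n v : quadop n 0 v = 0.
Proof.
by have := quadop_linl n 1 0 0 v; rewrite !scale1r addr0; exact: addr_idem.
Qed.

Lemma quadop_fsupp u v : fsupp u -> fsupp (fun n => quadop n (u n) v).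
Proof. by move=> [r ar]; exists r => n /ar ->; rewrite quadop0l. Qed.

Lemma diffop_act_linl c u b v : fsupp u -> fsupp b ->
  diffop_act (c *: u + b) v = c *: diffop_act u v + diffop_act b v.
Proof.
move=> sa sb; rewrite /diffop_act scalerDr fsumZ; last exact: quadop_fsupp.
rewrite addrACA -fsumD; last exact: quadop_fsupp.
  congr (_ + _); last by rewrite diffop_linE theta_lin scalerDl scalerA.
  by apply: fsumT_ext => n; rewrite diffop_linE quadop_linl.
by have [r h] := quadop_fsupp v sa; exists r => k /h ->; rewrite scaler0.
Qed.

Lemma diffop_act_tmon n f v : diffop_act (tmon n f) v = quadop n f v + ((n == 0)%:R * theta f) *: v.
Proof.
rewrite /diffop_act (fsum1 (k0 := n)) /tmon; last by move=> k /negPf ->; rewrite quadop0l.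
rewrite eqxx [0 == n]eq_sym; case: eqP => _; first by rewrite mul1r.
by rewrite theta0 mul0r.
Qed.

Lemma diffop_act_lin u c x y : fsupp u -> diffop_act u (c *: x + y) = c *: diffop_act u x + diffop_act u y.
Proof.
move=> sa; rewrite /diffop_act [c *: (_ + _)]scalerDr fsumZ; last exact: quadop_fsupp.
rewrite addrACA -fsumD; last exact: quadop_fsupp.
  congr (_ + _); last by rewrite scalerDr !scalerA mulrC.
  by apply: fsumT_ext => n; rewrite quadop_lin.
by have [r h] := quadop_fsupp x sa; exists r => k /h ->; rewrite scaler0.
Qed.

Lemma diffop_actD u x y : fsupp u -> diffop_act u (x + y) = diffop_act u x + diffop_act u y.
Proof. by move=> sa; have := diffop_act_lin 1 x y sa; rewrite !scale1r. Qed.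
Lemma diffop_act0r u : fsupp u -> diffop_act u 0 = 0.
Proof. by move=> sa; apply: addr_idem; rewrite -(diffop_actD 0 0 sa) addr0. Qed.
Lemma diffop_actZ u c x : fsupp u -> diffop_act u (c *: x) = c *: diffop_act u x.
Proof. by move=> sa; have := diffop_act_lin c x 0 sa; rewrite diffop_act0r// !addr0. Qed.
Lemma diffop_act0l v : diffop_act 0 v = 0.
Proof.
by rewrite /diffop_act theta0 scale0r addr0 fsbig1// => n _; rewrite quadop0l.
Qed.

(** The bracket relation for a pair of operators, with the central charge d *)
Definition diffop_act_bracket_at u b := forall v,
  diffop_act (dbr u b) v - (2^-1 * psi u b * d%:R) *: v =
  diffop_act u (diffop_act b v) - diffop_act b (diffop_act u v).

Lemma diffop_act_bracketC u b : fsupp u -> fsupp b -> fsupp (dbr u b) ->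
  diffop_act_bracket_at u b -> diffop_act_bracket_at b u.
Proof.
move=> su sb sab ab v.
have -> : diffop_act (dbr b u) v = - diffop_act (dbr u b) v.
  have := @diffop_act_linl (-1) (dbr u b) 0 v sab; rewrite addr0 diffop_act0l addr0 !scaleN1r => <-.
    by rewrite -dbrC.
  by exists [::].
rewrite (psiC _ sb) -[RHS]opprB -ab opprB mulrN mulNr scaleNr opprK.
exact: addrC.
Qed.

Lemma diffop_act_bracket_tmon m n f g : sym m f -> sym n g ->
  diffop_act_bracket_at (tmon m f) (tmon n g).
Proof.
have pos (i j : int) q r : sym i q -> sym j r -> (i + j = 0 -> 0 <= i) ->
    diffop_act_bracket_at (tmon i q) (tmon j r).
  move=> qs rs ij v; rewrite dbr_tmon !diffop_act_tmon.
  (* The constant terms do not contribute to the commutator. *)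
  set sq := (_ * theta q); set sr := (_ * theta r).
  have -> : quadop i q (quadop j r v + sr *: v) + sq *: (quadop j r v + sr *: v) -
     (quadop j r (quadop i q v + sq *: v) + sr *: (quadop i q v + sq *: v)) =
     quadop i q (quadop j r v) - quadop j r (quadop i q v).
    have := quadopD i q (quadop j r v) (sr *: v); rewrite (quadopZ i q sr v) => ->.
    have := quadopD j r (quadop i q v) (sq *: v); rewrite (quadopZ j r sq v) => ->.
    move: (quadop i q) (quadop j r) => A B.
    rewrite !scalerDr !scalerA [sr * sq]mulrC.
    move: (A (B v)) (B (A v)) (sr *: A v) (sq *: B v) ((sq * sr) *: v).
    move=> x1 x2 x3 x4 x5.
    by apply/eqP; rewrite subr_eq !addrA subrK [x1 + x3 + x4]addrAC.
  rewrite quadop_bracket//; rewrite -addrA; congr (_ + _).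
  rewrite -scalerBl -[RHS]scaleNr; congr (_ *: _).
  have [ij0|ij0] := eqVneq (i + j) 0; last first.
    by rewrite psi_tmon0// !(mulr0, mul0r) subr0 oppr0.
  have i0 := ij ij0; case: i i0 ij qs sq ij0 => [i|//] _ _ qs sq ij0.
  have -> : j = - i%:Z by lia.
  rewrite mul1r mulr1 psi_tmon addrN eqxx mul1r theta_bracket.
  by rewrite absz_nat.
move=> fs gs; have [mn|mn] := boolP ((m + n != 0) || (0 <= m)).
  by apply: pos => // /eqP mn0; move: mn; rewrite mn0.
have sf := tmon_fsupp m f; have sg := tmon_fsupp n g.
apply: diffop_act_bracketC => //; first by rewrite dbr_tmon; exact: tmon_fsupp.
by apply: pos => // nm; move: mn; rewrite negb_or -ltNge => /andP[_]; lia.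
Qed.

(** By bilinearity, from the homogeneous case *)
Lemma diffop_act_bracket u b : Dsym u -> Dsym b -> diffop_act_bracket_at u b.
Proof.
have red x y c : Dsym x -> Dsym y -> Dsym c -> diffop_act_bracket_at x c -> diffop_act_bracket_at y c ->
    diffop_act_bracket_at (x + y) c.
  move=> [sx hx] [sy hy] [sc hc] h1 h2 v.
  have s1 : fsupp (dbr x c) by case: (@Dsym_dbr _ x c).
  have s2 : fsupp (dbr y c) by case: (@Dsym_dbr _ y c).
  rewrite -[x]scale1r dbr_linl// psi_linl// !diffop_act_linl// !scale1r mul1r.
  rewrite !(mulrDr, mulrDl) scalerDl (diffop_actD (diffop_act x v) (diffop_act y v) sc).
  have := h1 v; have := h2 v.
  move: (diffop_act (dbr x c) v) (diffop_act (dbr y c) v) (_ *: v) (_ *: v) => d1 d2 p1 p2.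
  move: (diffop_act x (diffop_act c v)) (diffop_act y (diffop_act c v)) (diffop_act c (diffop_act x v)) (diffop_act c (diffop_act y v)).
  move=> z1 z2 z3 z4 e2 e1.
  by rewrite opprD addrACA e1 e2 opprD addrACA.
move=> ha hb; move: u ha; apply: Dsym_ind.
- move=> v; rewrite dbr0l !diffop_act0l (_ : psi 0 b = 0); last first.
    by rewrite /psi fsbig1// => m _; rewrite psi0_0l psi0_0r subr0.
  by rewrite mulr0 mul0r scale0r diffop_act0r ?subr0//; case: hb.
- by move=> n f u fs ha h1 h2; apply: red => //; exact: Dsym_tmon.
- move=> m f fs; move: b hb.
  apply: Dsym_ind.
  + apply: diffop_act_bracketC.
    * by exists [::].
    * exact: tmon_fsupp.
    * by rewrite dbr0l; exists [::].
    move=> v; rewrite dbr0l !diffop_act0l (_ : psi 0 _ = 0); last first.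
      by rewrite /psi fsbig1// => k _; rewrite psi0_0l psi0_0r subr0.
    by rewrite mulr0 mul0r scale0r diffop_act0r ?subr0//; exact: tmon_fsupp.
  + move=> n g u gs ha h1 h2.
    have hf := Dsym_tmon fs; have hg := Dsym_tmon gs.
    have sw x : Dsym x -> diffop_act_bracket_at (tmon m f) x -> diffop_act_bracket_at x (tmon m f).
      by move=> hx; apply: diffop_act_bracketC; [case: hf|case: hx|case: (Dsym_dbr hf hx)].
    have hs : Dsym (tmon n g + u) by rewrite -[tmon n g]scale1r; exact: Dsym_lin.
    apply: diffop_act_bracketC; [by case: hs|by case: hf|by case: (Dsym_dbr hs hf)|].
    by apply: red => //; exact: sw.
  + by move=> n g gs; exact: diffop_act_bracket_tmon.
Qed.

(** The action of the central extension, in which c acts as d *)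
Definition hat_act (x : diffop_hat K) v := diffop_act x.1 v + (d%:R * x.2) *: v.

Lemma Dsym_fsupp (u : diffop K) : Dsym u -> fsupp u. Proof. by case. Qed.

Lemma hat_act_lie_module : lie_module (@dbr_hat K) (@Dplus_hat K) hat_act.
Proof.
split.
- move=> c x y v /Dplus_sub/Dsym_fsupp sx /Dplus_sub/Dsym_fsupp sy.
  rewrite /hat_act [(c *: x + y).1]/(c *: x.1 + y.1) [(c *: x + y).2]/(c * x.2 + y.2).
  rewrite (diffop_act_linl c v sx sy); move: (diffop_act x.1 v) (diffop_act y.1 v) => z1 z2.
  by rewrite mulrDr scalerDl scalerDr scalerA mulrCA addrACA.
- move=> x /Dplus_sub/Dsym_fsupp sx c v1 v2; rewrite /hat_act (diffop_act_lin c v1 v2 sx).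
  move: (diffop_act x.1 v1) (diffop_act x.1 v2) => z1 z2.
  by rewrite !scalerDr !scalerA [_ * c]mulrC addrACA.
- move=> x y v /Dplus_sub hx /Dplus_sub hy; rewrite /hat_act /=.
  have sx := Dsym_fsupp hx; have sy := Dsym_fsupp hy.
  rewrite (diffop_actD (diffop_act y.1 v) _ sx) (diffop_actZ _ v sx).
  rewrite (diffop_actD (diffop_act x.1 v) _ sy) (diffop_actZ _ v sy).
  have := diffop_act_bracket hx hy v.
  have -> : d%:R * (- 2^-1 * psi x.1 y.1) = - (2^-1 * psi x.1 y.1 * d%:R) by ring.
  rewrite scaleNr => ->.
  move: (diffop_act x.1 v) (diffop_act y.1 v) (diffop_act x.1 (diffop_act y.1 v)) (diffop_act y.1 (diffop_act x.1 v)).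
  move: (d%:R * y.2) (d%:R * x.2) => s t z3 z4 z1 z2.
  rewrite !scalerDr !scalerA [s * t]mulrC.
  move: (s *: z3) (t *: z4) (_ *: v) => x3 x4 x5.
  by apply/esym/eqP; rewrite subr_eq !addrA subrK [z1 + x3 + x4]addrAC.
Qed.

Lemma hat_act_c v : hat_act (c_hat K) v = d%:R *: v.
Proof. by rewrite /hat_act diffop_act0l add0r mulr1. Qed.

Lemma hat_act_L_hat n r v : hat_act (L_hat K n r) v =
  quadop n (Lpoly K n r) v + ((n == 0)%:R * theta (Lpoly K n r)) *: v.
Proof. by rewrite /hat_act /L_hat /= LgenE diffop_act_tmon mulr0 scale0r addr0. Qed.

Lemma npair_fsupp q n v : fsupp (fun k => npair q k (p%:Z * n - k) v).
Proof.
apply: fsupp_box; have [M aM] := a_bd v.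
exists (M + absz (p%:Z * n)%R)%N => k kM; rewrite /npair.
case: ifP => k0; first by rewrite aM ?a_0//; lia.
by rewrite [a q (_ - k) v]aM ?a_0//; lia.
Qed.

Lemma quadop_Lpoly n r v : quadop n (Lpoly K n r) v = (r`! * r`!)%:R *: (2^-1 *:
  \sum_(q < d) \sum_(k \in [set: int])
    (ps_exp (- kap k) r * ps_exp (- kap (p%:Z * n - k)) r) *: npair q k (p%:Z * n - k) v).
Proof.
rewrite fsum_exchange; last first.
  move=> q; apply: (fsupp_map (f := fun k => GRing.scale (ps_exp (- kap k) r * ps_exp (- kap (p%:Z * n - k)) r))) (npair_fsupp q n v).
  by move=> k; rewrite scaler0.
rewrite scalerA mulrC -scalerA /quadop; congr (_ *: _).
rewrite fsumZ; last first.
  apply: fsupp_sum => q.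
  apply: (fsupp_map (f := fun k => GRing.scale (ps_exp (- kap k) r * ps_exp (- kap (p%:Z * n - k)) r))) (npair_fsupp q n v).
  by move=> k; rewrite scaler0.
apply: fsumT_ext => k; rewrite -scaler_sumr scalerA.
have [->|k0] := eqVneq k 0.
  by rewrite [\sum_(q < d) _](_ : _ = npairs 0 (p%:Z * n - 0) v)// /npairs !big1 ?scaler0// => q _; rewrite /npair ltxx a0.
rewrite -/(npairs _ _ _); congr (_ *: _).
rewrite /coef Lpoly_horner kapB kap_mul /ps_exp natrM opprB.
rewrite -kap_eq0 in k0; move: (kap k) k0 => x x0; move: (n%:~R) => y.
have : r`!%:R != 0 :> K by rewrite pnatr_eq0 -lt0n fact_gt0.
move: (r`!%:R) => u u0.
rewrite [- x + y]addrC -[x - y]opprB [(- (y - x)) ^+ r]exprNn !exprS.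
move: ((- x) ^+ r) ((-1) ^+ r) ((y - x) ^+ r) => s1 s2 s3.
by field; rewrite u0 x0.
Qed.

End Heisenberg.

(** * Induced modules *)

Section Submodule.
Variables (K : fieldType) (S : lmodType K).

(** A linear subspace, given by a predicate in [Prop] *)
Record submod := Submod {
  submod_pred : S -> Prop;
  submod_zero : submod_pred 0;
  submod_lin : forall (c : K) x y,
    submod_pred x -> submod_pred y -> submod_pred (c *: x + y) }.

(** Its boolean version, on which the subtype structures are built *)
Definition submod_bool (M : submod) : {pred S} := fun v => `[< submod_pred M v >].

Fact submod_bool_closed M : subsemimod_closed (submod_bool M).
Proof.
apply: GRing.submod_closed_semi; split; first exact/asboolP/submod_zero.
by move=> c x y /asboolP Mx /asboolP My; apply/asboolP; exact: submod_lin.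
Qed.

HB.instance Definition _ M :=
  GRing.isSubmodClosed.Build K S (submod_bool M) (submod_bool_closed M).

(** A linear subspace as a module *)
Definition submod_type (M : submod) := {v : S | submod_bool M v}.
HB.instance Definition _ M := SubType.on (submod_type M).
HB.instance Definition _ M := [Choice of submod_type M by <:].
HB.instance Definition _ M := [SubChoice_isSubLmodule of submod_type M by <:].

End Submodule.

Section InducedModule.
Variables (K : fieldType) (L : lmodType K) (br : L -> L -> L) (G B : set L).
Variables (V : lmodType K) (actV : L -> V -> V) (S : lmodType K).
Variables (actS : L -> S -> S) (i : V -> S).
Hypothesis ind : is_induced br G B actV actS i.

(** An endomorphism of an induced module that fixes the generators is the
    identity. *)
Lemma induced_endo (f : S -> S) : equivariant G actS actS f -> (forall v, f (i v) = i v) ->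
  f =1 id.
Proof.
case: ind => modS eqi univ feq fi x.
have [g [_ gu]] := univ S actS i modS eqi.
have <- : g = f by apply: gu; split => //; apply/funext => v /=.
by have -> : g = id by apply: gu; split => //; split.
Qed.

(** A submodule that contains the generators is everything: the map to it given by
    the universal property, followed by the inclusion, is the identity. *)
Lemma induced_generated (M : submod S) :
  (forall a x y, G x -> G y -> G (a *: x + y)) ->
  (forall x y, G x -> G y -> G (br x y)) -> B `<=` G ->
  (forall v, submod_pred M (i v)) ->
  (forall x v, G x -> submod_pred M v -> submod_pred M (actS x v)) ->
  forall v, submod_pred M v.
Proof.
move=> Glin Gbr BG Mi Mact; case: ind => -[lin1 lin2 brS] [ilin iB] univ.
(* Off G the action is irrelevant, and the default value of insubd is used. *)
pose actM (x : L) (u : submod_type M) : submod_type M := insubd u (actS x (val u)).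
have actME x u : G x -> val (actM x u) = actS x (val u).
  move=> Gx; rewrite /actM insubdK//.
  by apply/asboolP/Mact => //; apply/asboolP; exact: (valP u).
have Mi' v : submod_bool M (i v) by exact/asboolP.
pose j v : submod_type M := Sub (i v) (Mi' v).
have jE v : val (j v) = i v by exact: SubK.
have valL a (x y : submod_type M) : val (a *: x + y) = a *: val x + val y.
  by rewrite linearP.
have modM : lie_module br G actM.
  split.
  - move=> a x y u Gx Gy; apply: val_inj.
    by rewrite linearP /= !actME ?lin1//; exact: Glin.
  - by move=> x Gx a u v; apply: val_inj; rewrite linearP /= !actME// linearP /= lin2.
  - move=> x y u Gx Gy; apply: val_inj.
    by rewrite linearB /= !actME ?brS//; exact: Gbr.
have eqj : equivariant B actV actM j.
  split.
  - by move=> a u v; apply: val_inj; rewrite linearP /= ?jE ilin.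
  - by move=> x v Bx; apply: val_inj; rewrite actME ?jE ?iB//; exact: BG.
have [f [[[flin fG] fj] _]] := univ _ actM j modM eqj.
have fid := @induced_endo (val \o f).
move=> v; have <- : val (f v) = v.
  apply: fid.
    split.
    - by move=> a x y; rewrite /comp flin; exact: valL.
    - by move=> x u Gx /=; rewrite fG// actME.
  by move=> u /=; have := congr1 (fun g => val (g u)) fj => /= ->.
by apply/asboolP; exact: (valP (f v)).
Qed.

End InducedModule.

(** * The eigenspaces of the isometry *)

Section Eigenspaces.
Variables (K : numFieldType) (h : vectType K) (form : {symmetric h}).
Variables (nu : 'End(h)) (p : nat) (w : K).
Hypothesis p_gt0 : (0 < p)%N.
Hypothesis nu_isom : isometry form form nu.
Hypothesis nu_period : forall x, iter p nu x = x.
Hypothesis w_prim : p.-primitive_root w.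

Let pn0 : p%:R != 0 :> K. Proof. by rewrite pnatr_eq0 -lt0n. Qed.

Lemma prim_neq0 : w != 0.
Proof.
apply/eqP => w0; have := prim_expr_order w_prim.
by rewrite w0 expr0n gtn_eqF// => /eqP; rewrite eq_sym oner_eq0.
Qed.

Lemma prim_exprz_mod (k m : int) : w ^ (k + p%:Z * m) = w ^ k.
Proof.
by rewrite expfzDr ?prim_neq0// -exprz_exp -exprnP (prim_expr_order w_prim) exp1rz mulr1.
Qed.

Lemma sformD x y z : form x (y + z) = form x y + form x z.
Proof. exact: linearDr. Qed.
Lemma sformZ c x y : form x (c *: y) = c * form x y.
Proof. exact: linearZr. Qed.
Lemma sformC x y : form x y = form y x.
Proof. by rewrite hermC expr0 mul1r. Qed.
Lemma sform0 x : form x 0 = 0. Proof. exact: linear0r. Qed.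
Lemma sform_sum x I (r : seq I) (F : I -> h) :
  form x (\sum_(i <- r) F i) = \sum_(i <- r) form x (F i).
Proof. exact: (big_morph _ (sformD x) (sform0 x)). Qed.

Lemma eigspP k x : reflect (nu x = w ^ k *: x) (x \in eigsp nu w k).
Proof.
rewrite /eigsp /passmx.leigenspace memv_ker !lfun_simp /= subr_eq0.
exact: eqP.
Qed.

Lemma iter_nuD j x y : iter j nu (x + y) = iter j nu x + iter j nu y.
Proof. by elim: j => //= j ->; rewrite linearD. Qed.
Lemma iter_nuZ j c x : iter j nu (c *: x) = c *: iter j nu x.
Proof. by elim: j => //= j ->; rewrite linearZ. Qed.

(** The averaging formula for the projection on the eigenspace h_(k) *)
Definition epr (k : int) (x : h) : h :=
  p%:R^-1 *: \sum_(j < p) (w ^ k) ^- j *: iter j nu x.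

Lemma epr_lin k : linear (epr k).
Proof.
move=> c x y; rewrite /epr scalerA mulrC -scalerA -scalerDr; congr (_ *: _).
rewrite scaler_sumr -big_split; apply: eq_bigr => j _ /=.
by rewrite iter_nuD iter_nuZ scalerDr !scalerA mulrC.
Qed.
Lemma eprD k x y : epr k (x + y) = epr k x + epr k y.
Proof. by have := epr_lin k 1 x y; rewrite !scale1r. Qed.
Lemma epr0 k : epr k 0 = 0.
Proof. by apply: addr_idem; rewrite -eprD addr0. Qed.

Lemma sum_cyclic (V : zmodType) (F : nat -> V) : F p = F 0%N ->
  \sum_(j < p) F j.+1 = \sum_(j < p) F j.
Proof.
by case: p p_gt0 => // n _ Fn; rewrite big_ord_recr big_ord_recl /= Fn addrC.
Qed.

Lemma wk_expp k : (w ^ k) ^+ p = 1.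
Proof. by rewrite exprnP exprz_exp mulrC -exprz_exp -exprnP (prim_expr_order w_prim) exp1rz. Qed.

Lemma wk_neq0 k : w ^ k != 0.
Proof. by rewrite expfz_neq0 ?prim_neq0. Qed.

Lemma epr_eigsp k x : epr k x \in eigsp nu w k.
Proof.
apply/eigspP; rewrite /epr linearZ scalerA mulrC -scalerA; congr (_ *: _).
rewrite linear_sum scaler_sumr /=.
rewrite -(sum_cyclic (F := fun j => w ^ k *: ((w ^ k) ^- j *: iter j nu x))).
  apply: eq_bigr => j _; rewrite linearZ /= scalerA exprS.
  by rewrite invfM mulrA mulfV ?mul1r// wk_neq0.
by rewrite wk_expp nu_period expr0.
Qed.

Lemma geom_root (z : K) : z ^+ p = 1 -> \sum_(j < p) z ^+ j = p%:R * (z == 1)%:R.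
Proof.
move=> zp; have [->|z1] := eqVneq z 1.
  by under eq_bigr do rewrite expr1n; rewrite sumr_const card_ord mulr1.
have /eqP := subrX1 z p; rewrite zp subrr eq_sym mulf_eq0 subr_eq0 (negPf z1) mulr0.
by move=> /eqP.
Qed.

Lemma epr_on_eigsp k s x : x \in eigsp nu w s -> epr k x = (w ^ k == w ^ s)%:R *: x.
Proof.
move=> /eigspP xs; have it j : iter j nu x = (w ^ s) ^+ j *: x.
  by elim: j => [|j IH]; rewrite ?scale1r//= IH linearZ /= xs scalerA -exprSr.
rewrite /epr; under eq_bigr do rewrite it scalerA -exprVn -exprMn.
rewrite -scaler_suml geom_root.
  rewrite scalerA mulKf//; congr (_%:R *: _).
  by rewrite -(inj_eq (mulfI (wk_neq0 k))) mulrA mulfV ?wk_neq0// mul1r mulr1 eq_sym.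
by rewrite exprMn exprVn !wk_expp invr1 mulr1.
Qed.

Lemma epr_sum x : \sum_(k < p) epr k%:Z x = x.
Proof.
rewrite /epr -scaler_sumr exchange_big /=.
rewrite (eq_bigr (fun j : 'I_p => (p%:R * (j == 0%N :> nat)%:R) *: iter j nu x)); last first.
  move=> j _; rewrite -scaler_suml; congr (_ *: _).
  rewrite (eq_bigr (fun k : 'I_p => (w ^- j) ^+ k)); last first.
    by move=> k _; rewrite -exprnP -!exprVn -!exprM mulnC.
  rewrite geom_root; last first.
    by rewrite -exprVn -exprM mulnC exprM exprVn (prim_expr_order w_prim) invr1 expr1n.
  congr (_ * _%:R); rewrite invr_eq1 -(prim_order_dvd w_prim).
  have [->|j0] := eqVneq (j : nat) 0%N; first by rewrite dvdn0.
  by rewrite gtnNdvd// lt0n.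
case: p p_gt0 pn0 => // n _ n0; rewrite big_ord_recl /= mulr1 big1 ?addr0.
  by rewrite scalerA mulVf ?scale1r.
by move=> i _; rewrite mulr0 scale0r.
Qed.

Lemma eigprojE k x : eigproj nu p w k x = epr k x.
Proof.
rewrite /eigproj; set U := eigsp nu w k; set V := (\sum_(s < p | _) _)%VS.
have V0 y : y \in V -> epr k y = 0.
  move=> /memv_sumP[v vs ->]; rewrite (big_morph _ (eprD k) (epr0 k)) big1// => s ks.
  by rewrite (epr_on_eigsp _ (vs s ks)) -exprnP (negPf ks) scale0r.
have UV : (U :&: V = 0)%VS.
  apply/eqP; rewrite -subv0; apply/subvP => y; rewrite memv_cap => /andP[yU yV].
  by have := epr_on_eigsp k yU; rewrite eqxx scale1r V0// => <-; exact: mem0v.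
(* It suffices to compare the two projections on each eigenspace. *)
rewrite -{1}(epr_sum x) linear_sum /= -[in RHS](epr_sum x).
rewrite (big_morph _ (eprD k) (epr0 k)); apply: eq_bigr => s _.
have ys := epr_eigsp s%:Z x; rewrite (epr_on_eigsp k ys).
case: eqVneq => [ks|ks].
  by rewrite scale1r daddv_pi_id// /U /eigsp ks.
have yV : epr s%:Z x \in V.
  by rewrite /V; apply: (subvP (sumv_sup s _ (subvv _))) => //.
rewrite scale0r.
have := daddv_pi_add UV (subvP (addvSr U V) _ yV).
rewrite [daddv_pi V U _]daddv_pi_id// 1?capvC// -[RHS]add0r.
exact: addIr.
Qed.

Lemma sform_iter j x y : form (iter j nu x) (iter j nu y) = form x y.
Proof. by elim: j => //= j IH; rewrite nu_isom. Qed.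

Lemma epr_adj k x y : form (epr k x) y = form x (epr (- k) y).
Proof.
rewrite sformC /epr !sformZ !sform_sum; congr (_ * _).
pose F j := (w ^ k) ^+ j * form x (iter j nu y).
transitivity (\sum_(j < p) F j).
  rewrite -(sum_cyclic (F := F)); last by rewrite /F wk_expp nu_period expr0.
  rewrite (reindex_inj rev_ord_inj) /=; apply: eq_bigr => j _.
  rewrite sformZ /F sformC.
  have jp : (p - j.+1 + j.+1 = p)%N by rewrite subnK.
  rewrite -(sform_iter (p - j.+1) x) -iterD jp nu_period; congr (_ * _).
  apply: (mulfI (expf_neq0 (p - j.+1) (wk_neq0 k))).
  by rewrite mulfV ?expf_neq0 ?wk_neq0// -exprD jp wk_expp.
by apply: eq_bigr => j _; rewrite /F sformZ -invr_expz exprVn invrK.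
Qed.

Lemma epr_idem k x : epr k (epr k x) = epr k x.
Proof. by rewrite (epr_on_eigsp _ (epr_eigsp k x)) eqxx scale1r. Qed.

Variables (d : nat) (alpha : d.-tuple h).
Hypothesis alpha_basis : basis_of fullv alpha.
Hypothesis alpha_orthonormal : orthonormal form alpha.

Lemma alpha_form (q q' : 'I_d) : form alpha`_q alpha`_q' = (q == q')%:R.
Proof.
move: alpha_orthonormal => /andP[/allP a1 a2].
have a3 : pairwise (fun u v => form u v == 0) alpha.
  move: a2; elim: (tval alpha) => //= u s IH /andP[h1 /IH ->]; rewrite andbT.
  by move: h1; rewrite /ortho_rec /= andbT.
have := a3 => /(pairwiseP 0) a4.
case: (ltngtP q q') => [qq|qq|/val_inj ->].
- by have := a4 q q' _ _ qq; rewrite !inE !size_tuple !ltn_ord => /(_ isT isT)/eqP ->; rewrite -val_eqE ltn_eqF.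
- by have := a4 q' q _ _ qq; rewrite !inE !size_tuple !ltn_ord => /(_ isT isT)/eqP; rewrite sformC => ->; rewrite -val_eqE gtn_eqF.
- by rewrite eqxx; apply/eqP/a1; rewrite mem_nth// size_tuple.
Qed.

Lemma alpha_expand x : x = \sum_(q < d) form alpha`_q x *: alpha`_q.
Proof.
have xs : x \in <<alpha>>%VS by rewrite (span_basis alpha_basis) memvf.
rewrite {1}(coord_span xs); apply: eq_bigr => q _; congr (_ *: _).
rewrite {2}(coord_span xs) sform_sum (bigD1 q)//= sformZ alpha_form eqxx mulr1.
rewrite big1 ?addr0// => i iq.
by rewrite sformZ alpha_form eq_sym (negPf iq) mulr0.
Qed.

(** The trace of the projection, computed in the orthonormal basis and in a basis
    of its image *)
Lemma epr_trace k : \sum_(q < d) form alpha`_q (epr k alpha`_q) = (\dim (eigsp nu w k))%:R.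
Proof.
set U := eigsp nu w k; pose b := vbasis U.
have bU : basis_of U b := vbasisP U.
have ex q : epr k alpha`_q = \sum_(i < \dim U) coord b i (epr k alpha`_q) *: b`_i.
  by apply: (coord_basis bU); exact: epr_eigsp.
transitivity (\sum_(q < d) \sum_(i < \dim U) coord b i (form alpha`_q b`_i *: epr k alpha`_q)).
  apply: eq_bigr => q _; rewrite {1}ex sform_sum; apply: eq_bigr => i _.
  by rewrite sformZ [RHS]linearZ /= mulrC.
rewrite exchange_big /= -[RHS]mulr1n -[RHS]/(1 *+ \dim U).
rewrite -[X in _ *+ X]card_ord -sumr_const; apply: eq_bigr => i _.
rewrite -linear_sum /=.
have -> : \sum_(q < d) form alpha`_q b`_i *: epr k alpha`_q = epr k b`_i.
  rewrite [in RHS](alpha_expand b`_i) (big_morph _ (eprD k) (epr0 k)); apply: eq_bigr => q _.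
  by have := epr_lin k (form alpha`_q b`_i) alpha`_q 0; rewrite epr0 !addr0.
have bi : b`_i \in U by apply: vbasis_mem; rewrite mem_nth// size_tuple.
rewrite (epr_on_eigsp _ bi) eqxx scale1r coord_free ?eqxx//.
exact: basis_free bU.
Qed.

End Eigenspaces.

(** * The modes on the induced module *)

Section TwistedModes.
Variables (K : numFieldType) (h : vectType K) (form : {symmetric h}).
Variables (nu : 'End(h)) (p : nat) (w : K).
Variables (S : lmodType K) (act : hhat_ambient h -> S -> S) (vac : S).
Hypothesis S_nu : is_S_nu form nu p w act vac.

Local Notation G := (hhat nu w).
Local Notation br := (hhat_br form p).
Local Notation amd := (amode nu p w act).

Lemma hhat_linE (c : K) (x y : hhat_ambient h) k :
  (c *: x + y).1 k = c *: x.1 k + y.1 k.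
Proof. by []. Qed.

Lemma hhat_lin2E (c : K) (x y : hhat_ambient h) :
  (c *: x + y).2 = c * x.2 + y.2 :> K.
Proof. by []. Qed.

Lemma hhat_lin (c : K) x y : G x -> G y -> G (c *: x + y).
Proof.
move=> [fx hx] [fy hy]; split.
  apply: (@sub_finite_set _ _ ([set k | x.1 k != 0] `|` [set k | y.1 k != 0])).
    move=> k; rewrite /mkset hhat_linE => xy.
    have [x0|] := eqVneq (x.1 k) 0; last by left.
    by right; move: xy; rewrite x0 scaler0 add0r.
  by rewrite finite_setU.
by move=> k; rewrite hhat_linE memvD// memvZ.
Qed.

Lemma hhat_central z : G (0, z).
Proof.
split; last by move=> k; exact: mem0v.
rewrite (_ : [set _ | _] = set0)//.
by apply/seteqP; split => k //=; rewrite eqxx.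
Qed.

(** The element x_(k) (x) t^(k/p) *)
Definition mode_elt (k : int) (x : h) : hhat_ambient h :=
  (fun j : int => if j == k then eigproj nu p w k x else 0, 0).

Lemma mode_elt_hhat k x : G (mode_elt k x).
Proof.
split.
  apply: (@sub_finite_set _ _ [set k]); last exact: finite_set1.
  by move=> j /=; have [|jk] := eqVneq j k; rewrite ?eqxx.
by move=> j /=; case: eqP => [->|_]; rewrite ?mem0v// /eigproj memv_pi.
Qed.

Let modS : lie_module br G act. Proof. by case: S_nu. Qed.

Lemma act_linl c x y v : G x -> G y -> act (c *: x + y) v = c *: act x v + act y v.
Proof. by case: modS => + _ _ Gx Gy; apply. Qed.
Lemma act_linr x : G x -> linear (act x).
Proof. by case: modS => _ + _; apply. Qed.
Lemma act_br x y v : G x -> G y ->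
  act (br x y) v = act x (act y v) - act y (act x v).
Proof. by case: modS => _ _ + Gx Gy; apply. Qed.

Lemma act0l v : act 0 v = 0.
Proof.
have := act_linl (-1) v (hhat_central 0) (hhat_central 0).
by rewrite !scaleN1r addNr => ->; rewrite addNr.
Qed.

Lemma actDr x u v : G x -> act x (u + v) = act x u + act x v.
Proof. by move=> Gx; have := act_linr Gx 1 u v; rewrite !scale1r. Qed.
Lemma act0r x : G x -> act x 0 = 0.
Proof. by move=> Gx; apply: addr_idem; rewrite -actDr// addr0. Qed.
Lemma actZr x c v : G x -> act x (c *: v) = c *: act x v.
Proof. by move=> Gx; have := act_linr Gx c v 0; rewrite act0r// !addr0. Qed.

Lemma vacP x : hhat_nonneg nu w x -> act x vac = x.2 *: vac.
Proof.
move=> Bx; case: S_nu => _ [_ /(_ x 1 Bx)] + _.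
by rewrite /C_act mulr1 scale1r => <-.
Qed.

Lemma endo_id (f : S -> S) : linear f -> (forall x v, G x -> f (act x v) = act x (f v)) ->
  f vac = vac -> f =1 id.
Proof.
move=> fl fG fv; apply: (induced_endo S_nu); first by split.
move=> z; have f0 : f 0 = 0.
  by have := fl 1 0 0; rewrite !scale1r addr0; exact: addr_idem.
by have := fl z vac 0; rewrite f0 !addr0 fv.
Qed.

Lemma br_central z x : br (0, z) x = 0.
Proof.
rewrite /hhat_br /= fsbig1// => k _.
by rewrite -[form _ _]/(form 0 _) linear0l mul0r.
Qed.

(** The action of C is an endomorphism that fixes the vacuum. *)
Lemma act_C v : act (0, 1) v = v.
Proof.
have GC := hhat_central 1.
apply: (endo_id (f := act (0, 1))) => //.
- exact: act_linr.
- move=> x u Gx; apply/eqP; rewrite -subr_eq0 -act_br//.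
  by rewrite br_central act0l.
- by rewrite vacP ?scale1r//; split.
Qed.

Lemma act_central z v : act (0, z) v = z *: v.
Proof.
have := act_linl z v (hhat_central 1) (hhat_central 0).
rewrite act_C -[act (0, 0) v]/(act 0 v) act0l [RHS]addr0 => <-.
congr (act _ v); congr pair; first by apply/funext => k; rewrite /= scaler0 addr0.
by rewrite /= addr0 -[_ *: _]/(z * 1) mulr1.
Qed.

Lemma brackE x y : br x y = (0, (br x y).2). Proof. by []. Qed.

Lemma act_comm x y v : G x -> G y ->
  act x (act y v) - act y (act x v) = (br x y).2 *: v.
Proof. by move=> Gx Gy; rewrite -act_br// brackE act_central. Qed.

Lemma br_mode_eltl k al x : (br (mode_elt k al) x).2 =
  form (eigproj nu p w k al) (x.1 (- k)) * (k%:~R / p%:R).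
Proof.
rewrite /= (@fsum1 _ _ k) ?eqxx// => j /negPf ->.
by rewrite linear0l mul0r.
Qed.

Lemma amode_lin al k : linear (amd al k).
Proof. exact: act_linr (mode_elt_hhat k al). Qed.

Lemma amode_comm al k be l v :
  amd al k (amd be l v) - amd be l (amd al k v) =
  ((k + l == 0)%:R * (k%:~R / p%:R)
     * form (eigproj nu p w k al) (eigproj nu p w l be)) *: v.
Proof.
rewrite [LHS]act_comm; [|exact: mode_elt_hhat|exact: mode_elt_hhat].
rewrite br_mode_eltl /=; congr (_ *: _).
have -> : (- k == l) = (k + l == 0) by apply/eqP/eqP; lia.
case: eqP => _; last by rewrite sform0 !mul0r.
by rewrite mul1r mulrC.
Qed.

(** The zero modes are central and kill the vacuum. *)
Lemma amode0 al v : amd al 0 v = 0.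
Proof.
have Gd := mode_elt_hhat 0 al.
(* Adding the zero mode to the identity gives an endomorphism that fixes the
   vacuum. *)
suff /(_ v) /= : (fun v => v + amd al 0 v) =1 id.
  by rewrite -[X in _ = X]addr0 => /addrI.
apply: endo_id.
- by move=> c x y; rewrite amode_lin scalerDr addrACA.
- move=> x u Gx; rewrite actDr//; congr (_ + _).
  apply/eqP; rewrite -subr_eq0 [X in X == 0]act_comm// br_mode_eltl.
  by rewrite mul0r mulr0 scale0r.
- rewrite /amode vacP /= ?scale0r ?addr0//; split => //= k k0.
  by rewrite lt_eqF.
Qed.

Lemma amode_vac al k : 0 <= k -> amd al k vac = 0.
Proof.
move=> k0; rewrite /amode vacP /= ?scale0r//; split; first exact: mode_elt_hhat.
by move=> j j0 /=; rewrite lt_eqF// (lt_le_trans j0 k0).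
Qed.

(** Every vector is killed by all modes of large index: these vectors form a
    submodule that contains the vacuum. *)
Lemma amode_bounded v : exists M : nat, forall al (k : int), M%:Z <= k -> amd al k v = 0.
Proof.
pose P (v : S) := exists M : nat, forall al (k : int), M%:Z <= k -> amd al k v = 0.
have P0 : P 0.
  by exists 0%N => al k _; apply: act0r; exact: mode_elt_hhat.
have PL c x y : P x -> P y -> P (c *: x + y).
  move=> [M hM] [N hN]; exists (maxn M N) => al k Mk.
  by rewrite amode_lin hM ?hN ?scaler0 ?addr0//; lia.
pose M := Submod P0 PL.
apply: (induced_generated S_nu (M := M)).
- exact: hhat_lin.
- by move=> x y _ _; exact: hhat_central.
- by move=> x [].
- move=> z; exists 0%N => al k k0.
  by rewrite /amode actZr ?[X in _ *: X]amode_vac ?scaler0//; exact: mode_elt_hhat.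
- move=> x u Gx [N hN].
  have [B hB] : exists B : nat, forall k : int, (B < `|k|)%N -> x.1 k = 0.
    case: Gx => /finite_seqP[r rE] _.
    exists (\max_(k <- r) `|k|)%N => k kB; apply/eqP; apply: contraT => xk.
    have kr : k \in r by have : [set` r] k by rewrite -rE.
    have := @leq_bigmax_seq _ r xpredT (fun k : int => `|k|%N) k kr isT.
    by rewrite leqNgt kB.
  exists (maxn N B.+1) => al k Nk.
  have Gd := mode_elt_hhat k al.
  have : amd al k (act x u) - act x (amd al k u) = 0.
    rewrite [LHS]act_comm// br_mode_eltl hB; last by lia.
    by rewrite sform0 mul0r scale0r.
  by rewrite hN ?act0r ?subr0//; lia.
Qed.

End TwistedModes.

(** * The structure constants *)

Section SymmetricPolynomials.
Variable K : numFieldType.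

Local Notation x1 := ('X : {poly {poly K}}).
Local Notation x2 := ('X%:P : {poly {poly K}}).

(** g(x1 + x2) *)
Definition lift_e1 (g : {poly K}) : {poly {poly K}} := map_poly polyC g \Po (x1 + x2).

Lemma lift_e1D f g : lift_e1 (f + g) = lift_e1 f + lift_e1 g.
Proof. by rewrite /lift_e1 rmorphD /= comp_polyD. Qed.
Lemma lift_e1M f g : lift_e1 (f * g) = lift_e1 f * lift_e1 g.
Proof. by rewrite /lift_e1 rmorphM /= comp_polyM. Qed.
Lemma lift_e10 : lift_e1 0 = 0.
Proof. by rewrite /lift_e1 rmorph0 comp_poly0. Qed.
Lemma lift_e1C c : lift_e1 c%:P = c%:P%:P.
Proof. by rewrite /lift_e1 map_polyC comp_polyC. Qed.
Lemma lift_e1X : lift_e1 'X = x1 + x2.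
Proof. by rewrite /lift_e1 map_polyX comp_polyX. Qed.

(** F is the sum over a <= i < b of terms g_i(x1+x2) (x1 x2)^i. *)
Definition sym_dec (a b : nat) (F : {poly {poly K}}) :=
  exists g : nat -> {poly K}, F = \sum_(a <= i < b) lift_e1 (g i) * (x1 * x2) ^+ i.

Lemma sym_decD a b F H : sym_dec a b F -> sym_dec a b H -> sym_dec a b (F + H).
Proof.
move=> [f ->] [g ->]; exists (fun i => f i + g i).
by rewrite -big_split; apply: eq_bigr => i _ /=; rewrite lift_e1D mulrDl.
Qed.

Lemma sym_decM a b q F : sym_dec a b F -> sym_dec a b (lift_e1 q * F).
Proof.
move=> [f ->]; exists (fun i => q * f i).
by rewrite mulr_sumr; apply: eq_bigr => i _ /=; rewrite lift_e1M mulrA.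
Qed.

Lemma sym_dec0 a b : sym_dec a b 0.
Proof.
by exists (fun=> 0); rewrite big1// => i _; rewrite lift_e10 mul0r.
Qed.

Lemma sym_dec_sum a b n (F : 'I_n -> {poly {poly K}}) :
  (forall j, sym_dec a b (F j)) -> sym_dec a b (\sum_(j < n) F j).
Proof.
move=> h; elim/big_ind: _ => //; [exact: sym_dec0|exact: sym_decD].
Qed.

Lemma sym_dec_e2 a b F : sym_dec a b F -> sym_dec a.+1 b.+1 (x1 * x2 * F).
Proof.
move=> [f ->]; exists (fun i => f i.-1).
rewrite big_add1 /= mulr_sumr; apply: eq_bigr => i _.
by rewrite exprS mulrCA.
Qed.

Lemma sym_dec_widen a b a' b' F : (a' <= a)%N -> (b <= b')%N ->
  sym_dec a b F -> sym_dec a' b' F.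
Proof.
move=> aa bb [f ->].
exists (fun i => if (a <= i < b)%N then f i else 0).
have [ab|ba] := leqP a b; last first.
  rewrite big_geq; last exact: ltnW.
  rewrite big1// => i _; case: ifP; last by rewrite lift_e10 mul0r.
  by move=> /andP[ai ib]; have := leq_ltn_trans ai (ltn_trans ib ba); rewrite ltnn.
rewrite [RHS](big_cat_nat (n := a))//=; last exact: leq_trans ab bb.
rewrite [X in _ = X + _]big_nat_cond [X in _ = X + _]big1 ?add0r; last first.
  by move=> i /andP[/andP[_ ia] _]; rewrite leqNgt ia /= lift_e10 mul0r.
rewrite [RHS](big_cat_nat (n := b))//= [X in _ = _ + X]big_nat_cond.
rewrite [X in _ = _ + X]big1 ?addr0; last first.
  by move=> i /andP[/andP[bi _] _]; rewrite ltnNge bi andbF lift_e10 mul0r.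
by apply: eq_big_nat => i ->.
Qed.

Lemma sym_dec_lift g : sym_dec 0 1 (lift_e1 g).
Proof. by exists (fun=> g); rewrite big_nat1 expr0 mulr1. Qed.

(** By the recursion p_(k+2) = (x1+x2) p_(k+1) - x1 x2 p_k of the power sums *)
Lemma sym_dec_powersum k : sym_dec 0 (k./2).+1 (x1 ^+ k + x2 ^+ k).
Proof.
suff : sym_dec 0 (k./2).+1 (x1 ^+ k + x2 ^+ k) /\
       sym_dec 0 (k.+1./2).+1 (x1 ^+ k.+1 + x2 ^+ k.+1) by case.
elim: k => [|k [IH1 IH2]].
  split.
    have -> : x1 ^+ 0 + x2 ^+ 0 = lift_e1 2%:P.
      by rewrite lift_e1C !expr0 !polyCMn !polyC1.
    exact: sym_dec_lift.
  by rewrite !expr1 -lift_e1X; exact: sym_dec_lift.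
split => //.
have -> : x1 ^+ k.+2 + x2 ^+ k.+2 = lift_e1 'X * (x1 ^+ k.+1 + x2 ^+ k.+1)
    + lift_e1 (- 1)%:P * (x1 * x2 * (x1 ^+ k + x2 ^+ k)).
  by rewrite lift_e1X lift_e1C !exprS !rmorphN !rmorph1 ?polyCN ?polyCN ?polyC1 ?polyC1; ring.
apply: sym_decD; apply: sym_decM.
  apply: sym_dec_widen IH2 => //.
  by rewrite ltnS half_leq.
by have := sym_dec_e2 IH1; apply: sym_dec_widen.
Qed.

Lemma sym_dec_mono a b :
  sym_dec (minn a b) ((a + b)./2).+1 (x1 ^+ a * x2 ^+ b + x1 ^+ b * x2 ^+ a).
Proof.
wlog ab : a b / (a <= b)%N.
  move=> H; case/orP: (leq_total a b) => [/H//|/H].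
  by rewrite minnC addnC addrC.
rewrite (minn_idPl ab) -(subnK ab); set k := (b - a)%N.
have -> : x1 ^+ a * x2 ^+ (k + a) + x1 ^+ (k + a) * x2 ^+ a =
   (x1 * x2) ^+ a * (x1 ^+ k + x2 ^+ k) by rewrite !exprD exprMn; ring.
have := sym_dec_powersum k; have -> : ((a + (k + a))./2 = k./2 + a)%N.
  by rewrite addnCA addnn halfD odd_double andbF add0n doubleK.
rewrite -addSn; move: (k./2.+1) (_ + _ : {poly {poly K}}) => c F hF.
elim: a {ab k} => [|n IH]; first by rewrite expr0 mul1r addn0.
by rewrite exprS -mulrA addnS; exact: sym_dec_e2.
Qed.

Lemma fpoly_dec r s n : sym_dec (minn r s) (r + s).+1 (fpoly K r s n).
Proof.
rewrite /fpoly; set N := (r + s).+1.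
have -> : (-1) ^+ s.+1 * ((x2 + n%:~R) ^+ N * x1 ^+ r * x2 ^+ s
   + (x1 + n%:~R) ^+ N * x1 ^+ s * x2 ^+ r) =
   \sum_(j < N.+1) lift_e1 (((-1) ^+ s.+1 * n%:~R ^+ (N - j) *+ 'C(N, j))%:P) *
     (x1 ^+ r * x2 ^+ (s + j) + x1 ^+ (s + j) * x2 ^+ r).
  have nE : n%:~R = (n%:~R)%:P%:P :> {poly {poly K}} by rewrite !rmorph_int.
  have mE : (-1) = (-1)%:P%:P :> {poly {poly K}} by rewrite !polyCN !polyC1.
  rewrite ![_ + n%:~R]addrC !exprDn !mulr_suml -big_split mulr_sumr.
  apply: eq_bigr => j _ /=; rewrite lift_e1C !polyCMn !polyCM !polyC_exp -nE -mE.
  rewrite !mulrnAl -mulrnDl mulrnAr; congr (_ *+ _).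
  rewrite !exprD; ring.
apply: sym_dec_sum => j; apply: sym_decM.
apply: sym_dec_widen (sym_dec_mono r (s + j)).
  by rewrite leq_min geq_minl (leq_trans (geq_minr _ _))// leq_addr.
by have := ltn_ord j; rewrite /N; lia.
Qed.

Lemma lift_e1_horner g (x y : K) : (lift_e1 g).[x%:P].[y] = g.[x + y].
Proof.
rewrite /lift_e1 horner_comp hornerD hornerX hornerC.
by rewrite -[(map_poly _ _).[_]]/(g \Po (x%:P + 'X)) horner_comp !hornerE.
Qed.

(** The decomposition of f^(r,s) evaluated on the line x1 + x2 = -m-n *)
Lemma struct_constE r s m n (x y : K) : x + y = - (m + n)%:~R ->
  (-1) ^+ s.+1 * ((y + n%:~R) ^+ (r + s).+1 * x ^+ r * y ^+ s
     + (x + n%:~R) ^+ (r + s).+1 * x ^+ s * y ^+ r) =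
  \sum_(minn r s <= i < (r + s).+1) struct_const K r s i m n * (x * y) ^+ i.
Proof.
move=> xy; have := xgetPex (fun=> 0) (fpoly_dec r s n).
rewrite -/(fcoef K r s n) => /= e.
have := congr1 (fun F : {poly {poly K}} => F.[x%:P].[y]) e.
rewrite horner_sum (big_morph (fun q : {poly K} => q.[y]) (id1 := 0) (op1 := +%R)); last 2 first.
- by move=> u v; rewrite hornerD.
- by rewrite horner0.
rewrite (eq_bigr (fun i => struct_const K r s i m n * (x * y) ^+ i)); last first.
  move=> i _; rewrite -/(lift_e1 _) hornerM [X in X = _]hornerM lift_e1_horner xy.
  by rewrite horner_exp hornerM hornerX hornerC horner_exp !hornerE /struct_const -opprD rmorphN.
move=> <-; rewrite /fpoly.
have nE : n%:~R = (n%:~R)%:P%:P :> {poly {poly K}} by rewrite !rmorph_int.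
have mE : (-1) = (-1)%:P%:P :> {poly {poly K}} by rewrite !polyCN !polyC1.
by rewrite nE mE !(hornerE, horner_exp).
Qed.

(** The brackets of the generators of D^+, modulo the central term *)
Lemma Lpoly_bracket r s m n :
  (Lpoly K m r \Po ('X + n%:~R%:P)) * Lpoly K n s
  - (Lpoly K n s \Po ('X + m%:~R%:P)) * Lpoly K m r =
  \sum_(minn r s <= i < (r + s).+1) struct_const K r s i m n *: Lpoly K (m + n) i.
Proof.
apply/eqP; rewrite -subr_eq0; apply/eqP/poly_natroots => N; move: (N%:R) => x {N}.
rewrite !(hornerD, hornerN, hornerM) !horner_shift !Lpoly_horner horner_sum.
set k := m + n; set y := - k%:~R - x.
have xy : y + x = - k%:~R by rewrite /y subrK.
rewrite (eq_bigr (fun i => - x * (struct_const K r s i m n * (y * x) ^+ i))); last first.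
  move=> i _; have -> : (y * x) ^+ i = (-1) ^+ i * ((x + k%:~R) ^+ i * x ^+ i).
    by rewrite -!exprMn; congr (_ ^+ _); rewrite /y; ring.
  by rewrite hornerZ Lpoly_horner !exprS; ring.
(* With x1 = y and x2 = x, the product x1 x2 is -(x+m+n) x. *)
rewrite -mulr_sumr -(struct_constE _ _ xy) /y.
have -> : - k%:~R - x + n%:~R = - (x + m%:~R) by rewrite /k rmorphD /=; ring.
have -> : x + n%:~R + m%:~R = x + k%:~R by rewrite /k rmorphD /=; ring.
have -> : x + m%:~R + n%:~R = x + k%:~R by rewrite /k rmorphD /=; ring.
rewrite -opprD [k%:~R + x]addrC ![(- (x + _)) ^+ _]exprNn.
move: (x + k%:~R) (x + n%:~R) (x + m%:~R) => c u v.
rewrite !exprS !exprD.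
have e (i : nat) : (-1) ^+ i * (-1) ^+ i = 1 :> K by rewrite -expr2 sqrr_sign.
have es := e s.
rewrite [LHS](_ : _ = ((-1) ^+ s * (-1) ^+ s - 1) * ((-1) ^+ s * (-1) ^+ r *
  c ^+ s * v * v ^+ r * v ^+ s * x * x ^+ r)); last by ring.
by rewrite es subrr mul0r.
Qed.

End SymmetricPolynomials.

(** * The central term *)

Section CentralTerm.
Variable K : numFieldType.

(** x^N (m-x)^N *)
Definition betapoly (N : nat) (m : K) : {poly K} := 'X^N * (m%:P - 'X) ^+ N.

Lemma betapoly_horner N m x : (betapoly N m).[x] = x ^+ N * (m - x) ^+ N.
Proof. by rewrite /betapoly !(hornerE, horner_exp). Qed.

Lemma betapoly_shift N m : betapoly N m \Po ('X + m%:P) = betapoly N (- m).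
Proof.
apply/eqP; rewrite -subr_eq0; apply/eqP/poly_natroots => n; move: (n%:R) => x {n}.
rewrite hornerD hornerN horner_shift !betapoly_horner -!exprMn.
have -> : (x + m) * (m - (x + m)) = x * (- m - x) by ring.
exact: subrr.
Qed.

(** On the line x1 + x2 = 0, the structure constants are the coefficients of an odd
    polynomial that is the difference of two translates of x^N (m-x)^N. *)
Lemma struct_const_zreg r s (m : int) :
  \sum_(minn r s <= i < (r + s).+1)
     struct_const K r s i m (- m) * ((-1) ^+ i * zeta_neg K (2 * i).+1) =
  zreg (betapoly (r + s).+1 m%:~R) - zreg (betapoly (r + s).+1 (- m%:~R)).
Proof.
have -> : betapoly (r + s).+1 m%:~R = betapoly (r + s).+1 (- m%:~R) +
   \sum_(minn r s <= i < (r + s).+1) (struct_const K r s i m (- m) * (-1) ^+ i) *: 'X^((2 * i).+1).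
  apply/eqP; rewrite -subr_eq0; apply/eqP/poly_natroots => n; move: (n%:R) => x {n}.
  rewrite !(hornerD, hornerN) horner_sum !betapoly_horner.
  rewrite (eq_bigr (fun i => x * (struct_const K r s i m (- m) * (x * - x) ^+ i))); last first.
    move=> i _; have -> : (x * - x) ^+ i = (-1) ^+ i * (x ^+ 2) ^+ i.
      by rewrite -exprMn; congr (_ ^+ _); ring.
    by rewrite hornerZ hornerXn exprS exprM; ring.
  rewrite -mulr_sumr -struct_constE ?subrr ?oppr0// rmorphN /=.
  rewrite [- x - _]addrC -[x - m%:~R]opprB.
  move: (m%:~R - x) (- m%:~R - x) => u v.
  rewrite [(- u) ^+ _]exprNn [(- x) ^+ s]exprNn [(- x) ^+ r]exprNn !exprS !exprD.
  have e (j : nat) : (-1) ^+ j * (-1) ^+ j = 1 :> K by rewrite -expr2 sqrr_sign.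
  transitivity (x * (x ^+ r * x ^+ s) * (v * (v ^+ r * v ^+ s)) * ((-1) ^+ s * (-1) ^+ s - 1)
     + x * (x ^+ r * x ^+ s) * (u * (u ^+ r * u ^+ s)) *
       (1 - ((-1) ^+ s * (-1) ^+ s) * ((-1) ^+ r * (-1) ^+ r))); first by ring.
  by rewrite !e mulr1 subrr !mulr0 addr0.
rewrite zregD zreg_sum addrC addKr.
by apply: eq_bigr => i _; rewrite zregZ zregXn mulrA.
Qed.

Lemma psi_Lgen r s (m : nat) :
  psi (Lgen K m%:Z r) (Lgen K (- m%:Z) s) = - \sum_(i < m) (betapoly (r + s).+1 m%:R).[i.+1%:R].
Proof.
rewrite !LgenE psi_tmon subrr eqxx mul1r /psi0 big_add1 /= big_mkord -sumrN.
apply: eq_bigr => i _; rewrite !Lpoly_horner betapoly_horner rmorphN /=.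
set x := i.+1%:R; set y := m%:R - x.
have -> : - x + m%:~R = y by rewrite addrC.
have -> : y - m%:~R = - x by rewrite /y addrAC subrr add0r.
rewrite [(- x) ^+ _]exprNn ![(- x) ^+ _]exprNn !exprS !exprD.
have e (j : nat) : (-1) ^+ j * (-1) ^+ j = 1 :> K by rewrite -expr2 sqrr_sign.
transitivity (- (((-1) ^+ r * (-1) ^+ r) * ((-1) ^+ s * (-1) ^+ s) *
    (x * (x ^+ r * x ^+ s) * (y * (y ^+ r * y ^+ s))))); first by ring.
by rewrite !e !mul1r.
Qed.

(** Bloch's regularization: the cocycle on the generators, corrected by the zeta
    values, is a monomial. *)
Lemma central_term r s (m n : int) : m + n = 0 ->
  - (2^-1 * psi (Lgen K m r) (Lgen K n s)) =
  \sum_(minn r s <= i < (r + s).+1)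
     struct_const K r s i m n * ((-1) ^+ i / 2 * zeta_neg K (2 * i).+1)
  + (((r + s).+1)`! ^ 2)%:R / (2 * ((2 * (r + s) + 3)`!)%:R) * m%:~R ^+ (2 * (r + s) + 3).
Proof.
move=> mn; have -> : n = - m by lia.
rewrite (eq_bigr (fun i => 2^-1 * (struct_const K r s i m (- m) * ((-1) ^+ i * zeta_neg K (2 * i).+1)))); last first.
  by move=> i _; field.
rewrite -mulr_sumr struct_const_zreg; set N := (r + s).+1.
have NE : (2 * (r + s) + 3 = (N + N).+1)%N by rewrite /N; lia.
have reg (M : nat) : zreg (betapoly N M%:R) - zreg (betapoly N (- M%:R)) =
    \sum_(i < M) (betapoly N M%:R).[i.+1%:R]
    - (N`! ^ 2)%:R / ((N + N).+1)`!%:R * M%:R ^+ (N + N).+1 :> K.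
  rewrite -betapoly_shift zreg_shift {3}/betapoly beta_integral -mulnn; ring.
have f0 : ((N + N).+1)`!%:R != 0 :> K by rewrite pnatr_eq0 -lt0n fact_gt0.
rewrite NE; case: m {mn} => M.
  rewrite psi_Lgen reg -pmulrn -/N.
  by move: f0; move: (((N + N).+1)`!%:R) (\sum_(i < M) _) => u v u0; field.
(* For negative m the two factors are exchanged: the cocycle, the difference of
   regularized sums and the odd power of m all change sign. *)
rewrite NegzE opprK psiC; last by rewrite LgenE; exact: tmon_fsupp.
rewrite psi_Lgen [(s + r)%N]addnC -/N rmorphN /= !opprK.
rewrite -[zreg _ - _]opprB -pmulrn reg.
have -> : (- M.+1%:R) ^+ (N + N).+1 = - M.+1%:R ^+ (N + N).+1 :> K.
  by rewrite exprNn exprS addnn -mul2n exprM sqrrN !expr1n mulr1 mulN1r.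
by move: f0; move: (((N + N).+1)`!%:R) (\sum_(i < M.+1) _) => u v u0; field.
Qed.

End CentralTerm.

(** * The representation on the twisted module *)

Section TwistedRepresentation.
Variables (K : numFieldType) (h : vectType K) (d : nat) (form : {symmetric h}).
Variables (p : nat) (nu : 'End(h)) (w : K) (alpha : d.-tuple h).
Variables (S : lmodType K) (act : hhat_ambient h -> S -> S) (vac : S).
Hypothesis p_gt0 : (0 < p)%N.
Hypothesis nu_isom : isometry form form nu.
Hypothesis nu_period : forall x, iter p nu x = x.
Hypothesis w_prim : p.-primitive_root w.
Hypothesis alpha_basis : basis_of fullv alpha.
Hypothesis alpha_orthonormal : orthonormal form alpha.
Hypothesis S_nu : is_S_nu form nu p w act vac.

(** The modes of the orthonormal basis *)
Definition alpha_mode (q : 'I_d) (k : int) : S -> S := amode nu p w act (tnth alpha q) k.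
(** dim h_(k) *)
Definition eigdim (k : int) : K := (\dim (eigsp nu w k))%:R.
(** The representation of (a) *)
Definition twrep : diffop_hat K -> S -> S := hat_act p alpha_mode eigdim.

(** The Gram matrix of the projections of the basis on h_(k) and h_(-k) *)
Let E (k : int) (q q' : 'I_d) : K :=
  form (epr nu p w k (tnth alpha q)) (epr nu p w (- k) (tnth alpha q')).

Let EE (k : int) q q' : E k q q' = form alpha`_q (epr nu p w (- k) alpha`_q').
Proof. by rewrite /E (epr_adj _ nu_isom)// epr_idem// !(tnth_nth 0). Qed.

Let b_lin (q : 'I_d) (k : int) : linear (alpha_mode q k). Proof. exact: (amode_lin S_nu). Qed.

Let b_comm (q : 'I_d) (k : int) (q' : 'I_d) (l : int) v :
  alpha_mode q k (alpha_mode q' l v) - alpha_mode q' l (alpha_mode q k v) =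
  ((k + l == 0)%:R * kap K p k * E k q q') *: v.
Proof.
rewrite /alpha_mode (amode_comm S_nu) !eigprojE//; congr (_ *: _).
have [kl|] := eqVneq (k + l) 0; last by rewrite !mul0r.
by rewrite /E (_ : l = - k)//; lia.
Qed.

Let b_bd v : exists M : nat, forall q (k : int), M%:Z <= k -> alpha_mode q k v = 0.
Proof. by have [M hM] := amode_bounded S_nu v; exists M => q k; exact: hM. Qed.

Let b0 q v : alpha_mode q 0 v = 0. Proof. exact: (amode0 S_nu). Qed.

Let D_per (k m : int) : eigdim (k + p%:Z * m) = eigdim k.
Proof. by rewrite /eigdim /eigsp (prim_exprz_mod p_gt0 w_prim). Qed.

Let trE (k : int) : \sum_(q < d) E k q q = eigdim (- k).
Proof. by under eq_bigr do rewrite EE; exact: epr_trace. Qed.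

Let D_opp (k : int) : eigdim (- k) = eigdim k.
Proof.
rewrite -trE /eigdim -(epr_trace p_gt0 nu_period w_prim alpha_basis alpha_orthonormal k).
by apply: eq_bigr => q _; rewrite EE -(epr_adj p_gt0 nu_isom nu_period w_prim) sformC.
Qed.

Let E_tr (k : int) : \sum_(q < d) E k q q = eigdim k.
Proof. by rewrite trE D_opp. Qed.

Let D_sum : \sum_(k < p) eigdim k%:Z = d%:R.
Proof.
rewrite /eigdim; under eq_bigr do
  rewrite -(epr_trace p_gt0 nu_period w_prim alpha_basis alpha_orthonormal).
rewrite exchange_big /= (eq_bigr (fun=> 1)) ?sumr_const ?card_ord// => q _.
rewrite -sform_sum (epr_sum nu p_gt0 w_prim) (alpha_form alpha_orthonormal).
by rewrite eqxx.
Qed.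

Let E_contr (k : int) q' (j : int) v : (p %| j + k)%Z ->
  \sum_(q < d) E k q q' *: alpha_mode q j v = alpha_mode q' j v.
Proof.
move=> /dvdzP[c jk].
have jE : j = - k + p%:Z * c by lia.
have wj : w ^ j = w ^ (- k) by rewrite jE (prim_exprz_mod p_gt0 w_prim).
rewrite /alpha_mode /amode.
set x := epr nu p w (- k) alpha`_q'.
transitivity (act (mode_elt nu p w j x) v).
  rewrite [X in mode_elt _ _ _ _ X](alpha_expand alpha_basis alpha_orthonormal).
  have lin c' u u' : act (mode_elt nu p w j (c' *: u + u')) v =
      c' *: act (mode_elt nu p w j u) v + act (mode_elt nu p w j u') v.
    rewrite -(act_linl S_nu)//; [|exact: mode_elt_hhat|exact: mode_elt_hhat].
    congr (act _ v); rewrite [RHS]surjective_pairing /mode_elt; congr pair.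
      apply/funext => i; rewrite hhat_linE /=.
      by case: eqP => _; rewrite ?linearP// scaler0 addr0.
    by rewrite [RHS]hhat_lin2E /= mulr0 addr0.
  have z0 : act (mode_elt nu p w j 0) v = 0.
    by have := lin (-1) 0 0; rewrite scaler0 addr0 scaleN1r addNr.
  have D u u' : act (mode_elt nu p w j (u + u')) v =
      act (mode_elt nu p w j u) v + act (mode_elt nu p w j u') v.
    by have := lin 1 u u'; rewrite !scale1r.
  rewrite (big_morph (fun u => act (mode_elt nu p w j u) v) D z0); apply: eq_bigr => q _.
  by have := lin (form alpha`_q x) alpha`_q 0; rewrite z0 !addr0 EE (tnth_nth 0) => ->.
congr (act _ v); rewrite /mode_elt; congr pair; apply/funext => i.
case: eqP => // ij; rewrite !eigprojE// (tnth_nth 0).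
by rewrite /x /epr -wj -/(epr nu p w j _) -/(epr nu p w j _) epr_idem.
Qed.

Lemma twrep_lie_module : lie_module (@dbr_hat K) (@Dplus_hat K) twrep.
Proof. exact: (hat_act_lie_module p_gt0 b_lin b_comm E_contr E_tr D_per D_opp b0 b_bd D_sum). Qed.

Lemma twrep_c v : twrep (c_hat K) v = d%:R *: v.
Proof. exact: hat_act_c. Qed.

Lemma theta_Lpoly0 r :
  theta p eigdim (Lpoly K 0 r) = (r`! * r`!)%:R * corr (num_z nu p w) r%:Z r.
Proof.
rewrite corr_num_z /theta.
have -> : Lpoly K 0 r = (-1) ^+ r.+1 *: 'X^((2 * r).+1).
  rewrite /Lpoly mulr0z addr0 -exprD; congr (_ *: 'X^_); lia.
rewrite PsumZ PsumXn; under eq_bigr do rewrite hornerZ mulrCA.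
by rewrite -mulr_sumr exprS; ring.
Qed.

Lemma L_op_twrep n r v : L_op nu p w act alpha r r n v = twrep (L_hat K n r) v.
Proof.
rewrite /twrep hat_act_L_hat// quadop_Lpoly// /L_op scalerDr [X in _ + X = _]scalerA.
congr (_ + _ *: _).
case: eqP => [->|_]; last by rewrite !mul0r mulr0.
by rewrite !mul1r theta_Lpoly0.
Qed.

Lemma Lbar_op_L_op n r v : Lbar_op nu p w act alpha r r n v =
  L_op nu p w act alpha r r n v +
  ((n == 0)%:R * ((-1) ^+ r / 2 * zeta_neg K (2 * r).+1 * d%:R)) *: v.
Proof.
rewrite /Lbar_op /L_op pole0 subr0 !scalerDr -addrA; congr (_ + _).
rewrite !scalerA -scalerDl; congr (_ *: _).
rewrite mulrCA corr_numbar_z mulrDr -/(eigdim _).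
by rewrite (eq_bigr (fun k : 'I_p => eigdim k%:Z))// D_sum mulrCA.
Qed.

Lemma twrep_central n r (z : K) v :
  twrep (L_hat K n r + z *: c_hat K) v = L_op nu p w act alpha r r n v + (z * d%:R) *: v.
Proof.
have [lin _ _] := twrep_lie_module.
rewrite addrC lin; last 2 first.
- by rewrite /Dplus_hat /= => P P0 _ _ _.
- by move=> P _ _ _ XP; apply: XP; exists n, r.
by rewrite twrep_c L_op_twrep scalerA addrC.
Qed.

Lemma Lbar_op_twrep n r v : Lbar_op nu p w act alpha r r n v =
  twrep (L_hat K n r + ((-1) ^+ r / 2 * zeta_neg K (2 * r).+1 * (n == 0)%:R) *: c_hat K) v.
Proof. by rewrite twrep_central Lbar_op_L_op [_ * (n == 0)%:R]mulrC mulrA. Qed.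

Lemma Lbar_op_bracket r s m n v :
  let Lbr k i := Lbar_op nu p w act alpha i i k in
  Lbr m r (Lbr n s v) - Lbr n s (Lbr m r v) =
  \sum_(minn r s <= i < (r + s).+1) struct_const K r s i m n *: Lbr (m + n) i v
  + ((((r + s).+1)`! ^ 2)%:R / (2 * ((2 * (r + s) + 3)`!)%:R)
      * m%:~R ^+ (2 * (r + s) + 3) * (m + n == 0)%:R * d%:R) *: v.
Proof.
move=> Lbr.
pose u k i : diffop_hat K := L_hat K k i + ((k == 0)%:R * ((-1) ^+ i / 2 * zeta_neg K (2 * i).+1)) *: c_hat K.
have LbrE k i x : Lbr k i x = twrep (u k i) x.
  by rewrite /u twrep_central /Lbr Lbar_op_L_op mulrA.
have u1 k i : (u k i).1 = Lgen K k i by rewrite /u /= scaler0 addr0.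
have uD k i : Dplus_hat (u k i).
  by rewrite /Dplus_hat /mkset u1 => P _ _ _ XP; apply: XP; exists k, i.
have [_ _ br] := twrep_lie_module.
have := br _ _ v (uD m r) (uD n s); rewrite -!LbrE => <-; rewrite /dbr_hat !u1.
rewrite /twrep {1}/hat_act /= !LgenE dbr_tmon Lpoly_bracket -!LgenE.
set a := struct_const K r s.
have T : diffop_act p alpha_mode eigdim (tmon (m + n) (\sum_(minn r s <= i < (r + s).+1) a i m n *: Lpoly K (m + n) i)) v
   = \sum_(minn r s <= i < (r + s).+1) a i m n *: twrep (L_hat K (m + n) i) v.
  elim: (index_iota _ _) => [|i l IH].
    rewrite !big_nil (_ : tmon _ 0 = 0); first exact: diffop_act0l.
    by apply/funext => k; rewrite /tmon; case: ifP.
  rewrite !big_cons tmon_lin diffop_act_linl//; [|exact: tmon_fsupp|exact: tmon_fsupp].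
  by rewrite IH /twrep /hat_act /= mulr0 scale0r addr0 LgenE.
rewrite T [in RHS](eq_bigr (fun i => a i m n *: twrep (L_hat K (m + n) i) v +
   ((m + n == 0)%:R * (a i m n * ((-1) ^+ i / 2 * zeta_neg K (2 * i).+1)) * d%:R) *: v)); last first.
  move=> i _; rewrite LbrE /u twrep_central -L_op_twrep scalerDr [X in _ + X = _]scalerA.
  by congr (_ + _ *: _); ring.
rewrite big_split /= -addrA; congr (_ + _).
rewrite -scaler_suml -scalerDl; congr (_ *: _).
rewrite -mulr_suml -mulr_sumr mulrC -mulrDl; congr (_ * _).
have [mn|mn] := eqVneq (m + n) 0; last first.
  by rewrite !LgenE psi_tmon0// !(mulr0, mul0r) addr0.
by rewrite mul1r mulr1 mulNr central_term.
Qed.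

End TwistedRepresentation.
Theorem theorem7p3 (R : realType) (h : vectType R[i]) (d : nat)
    (dim_h : \dim {:h} = d)
    (form : {symmetric h}) (form_nondeg : nondegenerate form)
    (p : nat) (p_ge1 : (1 <= p)%N)
    (nu : 'End(h)) (nu_isom : isometry form form nu)
    (nu_period : forall x, iter p nu x = x)
    (nu_lattice : exists2 Lam : set h,
       rational_lattice form Lam & nu @` Lam = Lam)
    (w : R[i]) (w_prim : p.-primitive_root w)
    (alpha : d.-tuple h) (alpha_basis : basis_of fullv alpha)
    (alpha_orthonormal : orthonormal form alpha)
    (S : lmodType R[i]) (act : hhat_ambient h -> S -> S) (vac : S)
    (S_nu : is_S_nu form nu p w act vac) :
  let Lr (n : int) (r : nat) : S -> S := L_op nu p w act alpha r r n in
  let Lbr (n : int) (r : nat) : S -> S := Lbar_op nu p w act alpha r r n in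
  defines_representation (L_hat R[i]) Lr d%:R
  /\
  (defines_representation (Lbar_hat R) Lbr d%:R
   /\
   forall (r s : nat) (m n : int) (v : S),
     Lbr m r (Lbr n s v) - Lbr n s (Lbr m r v)
     = \sum_(minn r s <= i < (r + s).+1)
          struct_const R[i] r s i m n *: Lbr (m + n) i v
       + ((((r + s).+1)`! ^ 2)%:R / (2 * ((2 * (r + s) + 3)`!)%:R)
            * m%:~R ^+ (2 * (r + s) + 3) * (m + n == 0)%:R * d%:R) *: v).
Proof.
  (* your proof *)
Proof.
move=> Lr Lbr.
have mod : lie_module (@dbr_hat R[i]) (@Dplus_hat R[i]) (twrep p nu w alpha act).
  exact: (twrep_lie_module p_ge1 nu_isom nu_period w_prim alpha_basis alpha_orthonormal S_nu).
split; [|split].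
- exists (twrep p nu w alpha act); split => //.
  + by move=> n r v; apply/esym; exact: (L_op_twrep p_ge1 w_prim alpha_basis alpha_orthonormal S_nu).
  + by move=> v; exact: (twrep_c alpha p_ge1 S_nu).
- exists (twrep p nu w alpha act); split => //.
  + move=> n r v; rewrite /Lbar_hat zeta_odd; apply/esym.
    exact: (Lbar_op_twrep p_ge1 nu_isom nu_period w_prim alpha_basis alpha_orthonormal S_nu).
  + by move=> v; exact: (twrep_c alpha p_ge1 S_nu).
- by move=> r s m n v; exact: (Lbar_op_bracket p_ge1 nu_isom nu_period w_prim alpha_basis alpha_orthonormal S_nu).
Qed.
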